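(* Let $n\ge1$, $0<\tau<\frac{\pi}{4}$, $a=\cot\tau$ and $b=\sqrt{\cot^2\tau-1}$. Let $u:\mathbb{R}^n\to\mathbb{R}$ be a $C^2$ function satisfying $$\frac{\sqrt{a^2+1}}{2b}\sum_{i=1}^n\ln\frac{\lambda_i(x)+a-b}{\lambda_i(x)+a+b}=-u(x)+\frac12\langle x,Du(x)\rangle,\qquad x\in\mathbb{R}^n,$$ where $\lambda_1(x),\dots,\lambda_n(x)$ are the eigenvalues of the Hessian $D^2u(x)$. Assume that either $D^2u(x)>-(a-b)I$ for all $x\in\mathbb{R}^n$, or $D^2u(x)<-(a+b)I$ for all $x\in\mathbb{R}^n$. Then $u$ is a quadratic polynomial. Furthermore, there exists a symmetric real $n\times n$ matrix $A$ such that $$u(x)=-\frac{\sqrt{a^2+1}}{2b}\sum_{i=1}^n\ln\frac{\bar\lambda_i+a-b}{\bar\lambda_i+a+b}+\frac12\langle x,Ax\rangle\qquad\text{for all }x\in\mathbb{R}^n,$$ where $\bar\lambda_1,\dots,\bar\lambda_n$ are the eigenvalues of $A$.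
   Context: $\langle\cdot,\cdot\rangle$ is the standard inner product on $\mathbb{R}^n$, $Du$ is the gradient, $I$ is the identity matrix, and inequalities between symmetric matrices are in the sense of quadratic forms (strict inequality means the difference is positive definite). ''Quadratic polynomial'' means a polynomial of degree at most $2$. *)

(* Defs.v *)
From HB Require Import structures.
From mathcomp Require Import all_boot all_order all_algebra.
(* The notations of mpoly clash with those of all_analysis. *)
From mathcomp Require Import -(notations) mpoly.
From mathcomp Require Import all_classical all_reals all_analysis.

Set Implicit Arguments.
Unset Strict Implicit.
Unset Printing Implicit Defensive.

Import Order.TTheory GRing.Theory Num.Theory.
Import numFieldNormedType.Exports.

Local Open Scope classical_set_scope.
Local Open Scope ring_scope.

Definition cot (R : realType) (x : R) : R := cos x / sin x.

(* Vectors of R^n are row vectors, so the image of x under the linear map with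
   matrix M is x *m M^T; this is x *m M when M is symmetric. *)
Definition dotv (R : realType) (n : nat) (x y : 'rV[R]_n) : R :=
  \sum_(i < n) x 0 i * y 0 i.

Definition partial (R : realType) (n : nat) (i : 'I_n) (f : 'rV[R]_n -> R) :
  'rV[R]_n -> R := fun x => 'D_(delta_mx 0 i) f x.

Definition gradient (R : realType) (n : nat) (f : 'rV[R]_n -> R)
  (x : 'rV[R]_n) : 'rV[R]_n := \row_i partial i f x.

Definition hessian (R : realType) (n : nat) (f : 'rV[R]_n -> R)
  (x : 'rV[R]_n) : 'M[R]_n := \matrix_(i, j) partial i (partial j f) x.

(* 'D_v f is total, hence the explicit existence of the partial derivatives. *)
Definition class_C1 (R : realType) (n : nat) (f : 'rV[R]_n -> R) : Prop :=
  continuous f /\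
  forall i : 'I_n,
    (forall x : 'rV[R]_n, derivable f x (delta_mx 0 i)) /\
    continuous (partial i f).

Definition class_C2 (R : realType) (n : nat) (f : 'rV[R]_n -> R) : Prop :=
  class_C1 f /\ forall i : 'I_n, class_C1 (partial i f).

Definition posdefmx (R : realType) (n : nat) (M : 'M[R]_n) : Prop :=
  forall v : 'rV[R]_n, v != 0 -> 0 < dotv v (v *m M^T).

Definition mxform_lt (R : realType) (n : nat) (M N : 'M[R]_n) : Prop :=
  posdefmx (N - M).

(* l lists all the eigenvalues of M, with multiplicity. *)
Definition eigenvalues_of (R : realType) (n : nat) (M : 'M[R]_n)
  (l : 'I_n -> R) : Prop :=
  char_poly M = \prod_(i < n) ('X - (l i)%:P).

(* msize p is one more than the total degree of p, and 0 for p = 0. *)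
Definition quadratic_polynomial (R : realType) (n : nat) (f : 'rV[R]_n -> R) :
  Prop :=
  exists p : mpoly n R,
    (msize p <= 3)%N /\
    forall x : 'rV[R]_n, f x = meval (fun i : 'I_n => x 0 i) p.

(* Main.v *)
Require Import Defs.
From HB Require Import structures.
From mathcomp Require Import all_boot all_order all_algebra.
From mathcomp Require Import spectral sesquilinear.
From mathcomp Require Import -(notations) complex.
From mathcomp Require Import -(notations) mpoly.
From mathcomp Require Import all_classical all_reals all_analysis.
From mathcomp Require Import ring lra.

(* Up to sign and a multiple of |x|^2 / 2 the potential becomes a convex [w]
   whose Hessian eigenvalues [mu_k] satisfy
     Theta := sum_k kappa ln (mu_k / (mu_k + beta)) = - w + <x, Dw> / 2,
   where the left-hand side is a concave function of the Hessian and is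
   negative.  Formally, differentiating twice gives L Theta = 0 with
   L = tr (F'(D^2 w) D^2) - <x, D> / 2, an operator without zeroth-order term.
   The function phi := w - w 0 - <x, Dw 0> is proper, and L phi <= n kappa - phi / 2,
   so phi is a barrier at infinity and Theta attains its maximum; by Hopf's strong
   maximum principle Theta is constant.  Then w - w 0 is homogeneous of degree 2
   and C^2 at the origin, hence a quadratic form.
     Since w is only C^2, the equation is never differentiated: with
   w_s x := s^-2 w (s x), the quotient (w_s - w) / (2 (s - 1)) tends to Theta
   locally uniformly as s -> 1 and, by concavity (Klein's trace inequality),
   satisfies a perturbed form of L (.) >= 0, which suffices for a weak maximum
   principle with test functions. *)

Set Implicit Arguments.
Unset Strict Implicit.
Unset Printing Implicit Defensive.

Import Order.TTheory GRing.Theory Num.Theory.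
Import numFieldNormedType.Exports.

Local Open Scope classical_set_scope.
Local Open Scope ring_scope.

(** * Calculus along lines *)

Section Lines.
Context {R : realType} {n : nat}.
Implicit Types (f d : 'rV[R]_n -> R) (x y v : 'rV[R]_n).

Lemma is_derive_line f x v (t k : R) :
  is_derive (x + t *: v) v f k <-> is_derive t 1 (fun s => f (x + s *: v)) k.
Proof.
have E : (fun h : R => h^-1 *: ((f \o shift (x + t *: v)) (h *: v) - f (x + t *: v)))
  = (fun h : R => h^-1 *: (((fun s => f (x + s *: v)) \o shift t) (h *: 1)
                           - f (x + t *: v))).
  apply/funext => h /=; congr (_ *: (f _ - _)).
  by rewrite -[h%:A]/(h * 1) mulr1 scalerDl addrCA.
split=> -[D <-]; apply: DeriveDef; rewrite /derivable /derive.
- by rewrite -E.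
- by rewrite -E.
- by rewrite E.
- by rewrite E.
Qed.

Lemma is_derive_continuous1 (f : R -> R) (t k : R) :
  is_derive t 1 f k -> {for t, continuous f}.
Proof.
by move=> [D _]; apply: differentiable_continuous; apply/derivable1_diffP.
Qed.

(** Giving the intermediate point by the fraction [c] covers increments of either sign at once. *)
Lemma MVT_signless (f df : R -> R) (a b : R) :
  (forall t : R, is_derive t 1 f (df t)) ->
  exists2 c, 0 < c < 1 & f b - f a = (b - a) * df (a + c * (b - a)).
Proof.
move=> D.
have C : continuous f by move=> t; exact: is_derive_continuous1 (D t).
have [ab|ba|<-] := ltgtP a b; last first.
- by exists (1 / 2); rewrite ?subrr ?mul0r// divr_gt0//= ltr_pdivrMr// mul1r ltr1n.
- have [c] := MVT ba (fun t _ => D t) (continuous_subspaceT C).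
  rewrite in_itv/= => /andP[bc ca] E.
  exists ((a - c) / (a - b)).
    rewrite divr_gt0 ?subr_gt0//=.
    by rewrite ltr_pdivrMr ?subr_gt0// mul1r ltrD2l ltrN2.
  rewrite -[_ - _]opprB E -mulrN opprB mulrC; congr (_ * df _).
  by field; rewrite subr_eq0 gt_eqF.
- have [c] := MVT ab (fun t _ => D t) (continuous_subspaceT C).
  rewrite in_itv/= => /andP[ac cb] E.
  exists ((c - a) / (b - a)).
    rewrite divr_gt0 ?subr_gt0//=.
    by rewrite ltr_pdivrMr ?subr_gt0// mul1r ltrD2r.
  rewrite E mulrC; congr (_ * df _).
  by field; rewrite subr_eq0 gt_eqF.
Qed.

Lemma constant_pos (G : R -> R) : (forall t : R, 0 < t -> is_derive t 1 G 0) ->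
  forall s t, 0 < s -> 0 < t -> G s = G t.
Proof.
move=> DG; suff key s t : 0 < s -> s <= t -> G s = G t.
  move=> s t s0 t0; have [st|/ltW ts] := leP s t; first exact: key.
  by apply/esym/key.
move=> s0 st; have pos r : r \in `[s, t] -> 0 < r.
  by rewrite in_itv/= => /andP[sr _]; exact: lt_le_trans sr.
have C : {within `[s, t], continuous G}.
  by apply: derivable_within_continuous => r /pos/DG[].
have [|c _ E] := MVT_segment (df := fun=> 0) st _ C.
  by move=> r rst; apply/DG/pos; apply: subset_itv_oo_cc rst.
by apply/esym/eqP; rewrite -subr_eq0 E mul0r.
Qed.

Lemma MVT_line f d v x (s : R) :
  (forall y, is_derive y v f (d y)) ->
  exists2 c, 0 < c < 1 & f (x + s *: v) - f x = s * d (x + (c * s) *: v).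
Proof.
move=> D.
have D1 (t : R) : is_derive t 1 (fun s => f (x + s *: v)) (d (x + t *: v)).
  by apply/is_derive_line.
have [c c01] := MVT_signless 0 s D1; rewrite scale0r addr0 subr0 add0r => E.
by exists c.
Qed.

Lemma continuous_line x v : continuous (fun t : R => x + t *: v).
Proof.
move=> t; apply: cvgD; first exact: cvg_cst.
by apply: cvgZr_tmp; exact: cvg_id.
Qed.

(** These are the points met by successive mean value theorems along [v] and [w]; [c = 1] is allowed
    because a full step along [v] occurs too. *)
Lemma near_segments (P : 'rV[R]_n -> Prop) x v w : (\forall y \near x, P y) ->
  \forall h \near (0 : R), forall c c' : R, 0 <= c <= 1 -> 0 < c' < 1 ->
    P (x + (c * h) *: v + (c' * h) *: w).
Proof.
move=> /nbhs_ballP[e /= e0 He].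
pose K := `|v| + `|w| + 1.
have K0 : 0 < K by rewrite /K ltr_wpDl// addr_ge0.
apply/nbhs_ballP; exists (e / K) => /=; first by rewrite divr_gt0.
move=> h; rewrite -ball_normE /= sub0r normrN => hlt c c' /andP[c0 c1] /andP[/ltW c'0 /ltW c'1].
apply: He; rewrite -ball_normE /= opprD addrA opprD addrA subrr sub0r.
rewrite -opprD normrN; apply: le_lt_trans (ler_normD _ _) _.
rewrite !normrZ ?normrM (ger0_norm c0) (ger0_norm c'0).
apply: (@le_lt_trans _ _ (`|h| * K)); last by rewrite -ltr_pdivlMr.
rewrite /K !mulrDr mulr1; apply: le_trans (_ : `|h| * `|v| + `|h| * `|w| <= _).
  by rewrite lerD// ler_wpM2r// ler_piMl.
by rewrite lerDl.
Qed.

Lemma is_derive_translate f v w y k :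
  is_derive (y + w) v f k -> is_derive y v (fun z => f (z + w)) k.
Proof.
have E : (fun h : R => h^-1 *: ((f \o shift (y + w)) (h *: v) - f (y + w)))
  = (fun h : R => h^-1 *: (((fun z => f (z + w)) \o shift y) (h *: v)
                           - f (y + w))).
  by apply/funext => h /=; rewrite addrA.
move=> -[D <-]; apply: DeriveDef; rewrite /derivable /derive.
- by rewrite -E.
- by rewrite -E.
Qed.

(** A positive [D] would make [dm] positive just to the right of 0, and the mean value theorem would
    push [m] above [m 0]. *)
Lemma second_derivative_test (m dm : R -> R) (D : R) :
  (forall t : R, is_derive t 1 m (dm t)) -> is_derive (0 : R) 1 dm D ->
  (\forall t \near (0 : R), m t <= m 0) -> dm 0 = 0 /\ D <= 0.
Proof.
move=> Dm DD /nbhs_ballP[e /= e0 He].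
have max (t : R) : t \in `](- e), e[ -> m t <= m 0.
  rewrite in_itv/= => /andP[t1 t2]; apply: He.
  by rewrite -ball_normE /= sub0r normrN ltr_norml t1.
have dm0 : dm 0 = 0.
  have h0 : (0 : R) \in `](- e), e[ by rewrite in_itv/= oppr_lt0 e0.
  have [_ <-] := Dm 0.
  have ee : - e <= e by rewrite (le_trans _ (ltW e0))// oppr_le0 ltW.
  have der (t : R) : t \in `](- e), e[ -> derivable m t 1 by have [] := Dm t.
  by have [] := derive1_at_max ee der h0 max.
split => //; rewrite leNgt; apply/negP => D0.
have [+ DE] := DD; rewrite /derivable => /cvg_ex[/= l Hl].
have lE : l = D by rewrite -DE /derive; apply/esym/cvg_lim.
rewrite lE in Hl.
have : \forall h \near 0^', 0 < h^-1 *: (dm (h *: 1 + 0) - dm 0).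
  exact: (cvgr_gt _ Hl _ D0).
move=> /nbhs_ballP[d /= d0 Hd].
pose t := Num.min d e / 2.
have t0 : 0 < t by rewrite /t divr_gt0// lt_min d0.
have td : t < d by rewrite /t ltr_pdivrMr// gt_min ltr_pMr// ltr1n.
have te : t < e.
  by rewrite /t ltr_pdivrMr// gt_min ltr_pMr// ltr1n// orbT.
have C : continuous m by move=> s; exact: is_derive_continuous1 (Dm s).
have [c] := MVT t0 (fun t _ => Dm t) (continuous_subspaceT C).
rewrite in_itv/= subr0 => /andP[c0 ct] E.
have dc : 0 < dm c.
  have := Hd c; rewrite -ball_normE /= sub0r normrN gtr0_norm// (lt_trans ct td).
  move=> /(_ isT); rewrite gt_eqF// => /(_ isT).
  rewrite dm0 subr0 addr0 -[c%:A]/(c * 1) mulr1 -[_ *: _]/(_ * _).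
  by rewrite pmulr_rgt0// invr_gt0.
have : m t <= m 0.
  by apply: max; rewrite in_itv/= te andbT (lt_trans _ t0)// oppr_lt0.
by rewrite -subr_le0 E leNgt mulr_gt0.
Qed.

(** Continuity forces [F 0 = 0]; the difference quotient from the right is then constantly [k]. *)
Lemma is_derive0_right (F : R -> R) (a k : R) : is_derive (0 : R) 1 F a ->
  (forall t, 0 < t -> F t = k * t) -> a = k.
Proof.
move=> DF HF; have cF := is_derive_continuous1 DF.
have near_pos : \forall t \near (0 : R)^'+, 0 < t by exact: nbhs_right_gt.
have c0 : k * t @[t --> (0 : R)] --> k * 0.
  by apply: cvgM; [exact: cvg_cst|exact: cvg_id].
have F0 : F 0 = 0.
  have H1 : F t @[t --> (0 : R)^'+] --> F 0 by exact: cvg_at_right_filter.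
  have H2 : F t @[t --> (0 : R)^'+] --> k * 0.
    have H3 : k * t @[t --> (0 : R)^'+] --> k * 0 by exact: (@cvg_at_right_filter _ _ (fun t => k * t)).
    apply: cvg_trans H3; apply: near_eq_cvg.
    by apply: filterS near_pos => t t0; rewrite HF.
  by rewrite (cvg_unique _ H1 H2) ?mulr0.
have [D <-] := DF.
rewrite ['D_1 F 0](cvg_at_rightE (fun h : R => h^-1 *: ((F \o shift 0) (h *: 1) - F 0)))//.
apply: cvg_lim => //; apply: cvg_trans (_ : (fun=> k) @ (0 : R)^'+ --> k); last exact: cvg_cst.
apply: near_eq_cvg; apply: filterS near_pos => t t0 /=.
rewrite F0 subr0 addr0 -[_ *: 1]/(t * 1) mulr1 HF// -[_ *: _]/(_ * _).
by rewrite mulrCA mulVf ?mulr1// gt_eqF.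
Qed.

End Lines.

(** * Directional derivatives of C^1 functions and symmetry of second derivatives *)

Section C1.
Context {R : realType} {n : nat}.
Implicit Types (f d : 'rV[R]_n -> R) (x y v : 'rV[R]_n).

Lemma is_derive_partial f x (i : 'I_n) :
  derivable f x (delta_mx 0 i) -> is_derive x (delta_mx 0 i) f (partial i f x).
Proof. by move=> D; apply: DeriveDef. Qed.

(** Directions are added one at a time: the mean value theorem handles the new increment at the
    point already moved by the others, and continuity of the partial derivative gives the limit. *)
Lemma class_C1_is_derive_seq f (x v : 'rV[R]_n) (r : seq 'I_n) : class_C1 f ->
  is_derive x (\sum_(i <- r) v 0 i *: delta_mx 0 i) f
              (\sum_(i <- r) v 0 i * partial i f x).
Proof.
move=> [cf Df]; elim: r => [|i r IHr].
  by rewrite !big_nil; exact: is_derive0.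
rewrite !big_cons; set w := \sum_(j <- r) _ in IHr *.
set S := \sum_(j <- r) _ in IHr *.
have D y : is_derive y (delta_mx 0 i) f (partial i f y).
  exact/is_derive_partial/(Df i).1.
have [dw Dw] := IHr.
have {dw Dw}cw : h^-1 *: (f (h *: w + x) - f x) @[h --> 0^'] --> S.
  by move/cvg_ex: dw => [l Hl]; rewrite -Dw (_ : 'D_w f x = l)//; exact/cvg_lim.
suff H : h^-1 *: (f (h *: (v 0 i *: delta_mx 0 i + w) + x) - f x) @[h --> 0^']
    --> v 0 i * partial i f x + S.
  by apply: DeriveDef; [apply/cvg_ex; eexists; exact: H|exact/cvg_lim].
pose q (h : R) :=
  h^-1 *: (f (h *: (v 0 i *: delta_mx 0 i + w) + x) - f (h *: w + x)).
have -> : (fun h : R => h^-1 *: (f (h *: (v 0 i *: delta_mx 0 i + w) + x) - f x))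
    = q \+ (fun h => h^-1 *: (f (h *: w + x) - f x)).
  by apply/funext => h /=; rewrite /q -scalerDr addrA subrK.
apply: cvgD cw; apply/cvgrPdist_lt => e e0.
pose e' := e / (`|v 0 i| + 1).
have e'0 : 0 < e' by rewrite divr_gt0// ltr_wpDl.
have /cvgrPdist_lt/(_ _ e'0) C := (Df i).2 x.
have := near_segments w (v 0 i *: delta_mx 0 i) C => N.
near=> h.
have h0 : h != 0 by near: h; exact: nbhs_dnbhs_neq.
have [c c01] := MVT_line (h *: w + x) (h * v 0 i) D.
rewrite /q; have -> : h *: (v 0 i *: delta_mx 0 i + w) + x =
    h *: w + x + (h * v 0 i) *: delta_mx 0 i.
  by rewrite scalerDr scalerA -addrA addrC.
move=> ->; rewrite -[_ *: _]/(_ * _) !mulrA mulVf// mul1r -mulrBr normrM.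
apply: (@le_lt_trans _ _ (`|v 0 i| * e')).
  apply: ler_wpM2l => //; apply: ltW.
  have : forall c c' : R, 0 <= c <= 1 -> 0 < c' < 1 -> `|partial i f x -
      partial i f (x + (c * h) *: w + (c' * h) *: (v 0 i *: delta_mx 0 i))| < e'.
    near: h; exact: nbhs_dnbhs.
  move=> /(_ 1 c); rewrite ler01 lexx mul1r => /(_ isT c01).
  by rewrite [x + _]addrC scalerA.
by rewrite /e' mulrA ltr_pdivrMr ?ltr_wpDl// mulrC ltr_pM2l// ltrDl.
Unshelve. all: by end_near. Qed.

Lemma class_C1_is_derive f (x v : 'rV[R]_n) : class_C1 f ->
  is_derive x v f (dotv v (gradient f x)).
Proof.
move=> cf; have := class_C1_is_derive_seq x v (index_enum 'I_n) cf.
rewrite -row_sum_delta; congr is_derive.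
by apply: eq_bigr => i _; rewrite mxE.
Qed.

(** Schwarz's theorem: the second difference quotient is symmetric in [i] and [j] and tends to
    either mixed derivative, by two mean value theorems. *)
Lemma partial_comm f (i j : 'I_n) (x : 'rV[R]_n) : class_C2 f ->
  partial i (partial j f) x = partial j (partial i f) x.
Proof.
move=> [[cf Df] D2f].
pose D (a b : 'I_n) h := f (x + h *: delta_mx 0 a + h *: delta_mx 0 b)
  - f (x + h *: delta_mx 0 a) - (f (x + h *: delta_mx 0 b) - f x).
have DC a b h : D a b h = D b a h.
  by rewrite /D [x + _ + _]addrAC; ring.
suff key (a b : 'I_n) (e : R) : 0 < e -> \forall h \near (0 : R)^',
   `|partial a (partial b f) x - D a b h / h ^+ 2| < e.
  apply/eqP; rewrite -subr_eq0 -normr_le0; apply/ler_addgt0Pl => e e0.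
  rewrite addr0 (splitr e).
  have e20 : 0 < e / 2 by rewrite divr_gt0.
  near (0 : R)^' => h; rewrite -(subrKA (D i j h / h ^+ 2)).
  apply: le_trans (ler_normD _ _) _; apply: lerD; apply: ltW.
    by near: h; exact: key.
  rewrite distrC DC.
  by near: h; exact: key.
move=> e0; have /cvgrPdist_lt/(_ _ e0) C := ((D2f b).2 a).2 x.
have := near_segments (delta_mx 0 b) (delta_mx 0 a) C => N.
near=> h.
have h0 : h != 0 by near: h; exact: nbhs_dnbhs_neq.
pose g (y : 'rV[R]_n) := f (y + h *: delta_mx 0 a) - f y.
have Dg (y : 'rV[R]_n) : is_derive y (delta_mx 0 b) g
    (partial b f (y + h *: delta_mx 0 a) - partial b f y).
  apply: is_deriveB; last exact/is_derive_partial/(Df b).1.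
  exact/is_derive_translate/is_derive_partial/(Df b).1.
have [c c01 E] := MVT_line x h Dg.
have D2 (y : 'rV[R]_n) : is_derive y (delta_mx 0 a) (partial b f)
    (partial a (partial b f) y).
  exact/is_derive_partial/((D2f b).2 a).1.
have [c' c'01 E'] := MVT_line (x + (c * h) *: delta_mx 0 b) h D2.
have -> : D a b h = h ^+ 2 * partial a (partial b f)
    (x + (c * h) *: delta_mx 0 b + (c' * h) *: delta_mx 0 a).
  rewrite expr2 -mulrA -E' -E /D [x + _ + _]addrAC /g; ring.
rewrite mulrAC mulfV ?mul1r ?expf_neq0//.
have : forall c c' : R, 0 <= c <= 1 -> 0 < c' < 1 ->
   `|partial a (partial b f) x - partial a (partial b f)
     (x + (c * h) *: delta_mx 0 b + (c' * h) *: delta_mx 0 a)| < e.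
  by near: h; exact: nbhs_dnbhs.
by apply => //; case/andP: c01 => /ltW -> /ltW ->.
Unshelve. all: by end_near. Qed.

End C1.

(** * Spectral resolutions and Klein's inequality *)

Section Spectral.
Context {R : realType} {n : nat}.

(** Both families list the roots of one polynomial, so they are permutations of each other. *)
Lemma eigenvalues_of_sum (M : 'M[R]_n) (l d : 'I_n -> R) (F : R -> R) :
  eigenvalues_of M l -> eigenvalues_of M d -> \sum_i F (l i) = \sum_i F (d i).
Proof.
rewrite /eigenvalues_of => -> E.
have P : perm_eq [seq l i | i <- index_enum 'I_n]
                           [seq d i | i <- index_enum 'I_n].
  by apply: prod_XsubC_eq; rewrite !big_map.
by have := perm_big _ P (op := +%R) (x := 0) (P := xpredT) (F := F); rewrite !big_map.
Qed.

Lemma char_poly_similar (F : fieldType) (P D : 'M[F]_n) : P \in unitmx ->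
  char_poly (invmx P *m D *m P) = char_poly D.
Proof.
move=> uP; have uP' : map_mx polyC P \in unitmx by rewrite map_unitmx.
rewrite /char_poly; have -> : char_poly_mx (invmx P *m D *m P) =
    invmx (map_mx polyC P) *m char_poly_mx D *m map_mx polyC P.
  rewrite /char_poly_mx !map_mxM map_invmx mulmxBr mulmxBl.
  by rewrite scalar_mxC -[_%:M *m _ *m _]mulmxA mulVmx// mulmx1.
by rewrite !det_mulmx mulrC mulrA -det_mulmx mulmxV// det1 mul1r.
Qed.

(* [X k + i Y k] is a complex unit eigenvector for the eigenvalue [d k]. *)
Definition spectral_resolution (M : 'M[R]_n) (d : 'I_n -> R)
    (X Y : 'I_n -> 'rV[R]_n) : Prop :=
  [/\ forall k, dotv (X k) (X k) + dotv (Y k) (Y k) = 1,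
      forall v w, \sum_k (dotv v (X k) * dotv w (X k) +
                          dotv v (Y k) * dotv w (Y k)) = dotv v w,
      forall k, X k *m M = d k *: X k &
      forall k, Y k *m M = d k *: Y k].

(** [M] is diagonalised as a complex Hermitian matrix. Its eigenvalues are real, so the real and
    imaginary parts of each row of the unitary matrix satisfy the same eigenvector equation. *)
Lemma spectral_resolution_exists (M : 'M[R]_n) : M^T = M ->
  exists d X Y, spectral_resolution M d X Y /\ eigenvalues_of M d.
Proof.
move=> Msym.
pose inj := (complex.real_complex_def (Phant R) : {rmorphism R -> complex.complex R}).
pose A := map_mx inj M.
have Aherm : A \is hermsymmx.
  apply: realsym_hermsym.
    apply/is_hermitianmxP; rewrite expr0 scale1r map_mx_id// map_trmx.
    by rewrite Msym.
  apply/mxOverP => i j; rewrite mxE.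
  by apply/complex.complex_realP; eexists.
have /orthomx_spectralP AE := hermitian_normalmx Aherm.
have Preal := hermitian_spectral_diag_real Aherm.
set P := spectralmx A in AE.
set sp := spectral_diag A in AE Preal.
have Pu : P \is unitarymx by exact: spectral_unitarymx.
pose d k := complex.Re (sp 0 k).
have dE k : sp 0 k = inj (d k).
  rewrite /d; have /complex.complex_realP[x ->//] := mxOverP Preal 0 k.
pose X k : 'rV[R]_n := \row_j complex.Re (P k j).
pose Y k : 'rV[R]_n := \row_j complex.Im (P k j).
have Rsum (I : Type) (r : seq I) (F : I -> complex.complex R) :
  complex.Re (\sum_(i <- r) F i) = \sum_(i <- r) complex.Re (F i).
  by elim/big_rec2: _ => // i a b _ <-; case: (F i); case: b.
have Isum (I : Type) (r : seq I) (F : I -> complex.complex R) :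
  complex.Im (\sum_(i <- r) F i) = \sum_(i <- r) complex.Im (F i).
  by elim/big_rec2: _ => // i a b _ <-; case: (F i); case: b.
have ReM (a b : complex.complex R) : complex.Re (a * b) =
   complex.Re a * complex.Re b - complex.Im a * complex.Im b.
  by case: a; case: b.
have ImM (a b : complex.complex R) : complex.Im (a * b) =
   complex.Re a * complex.Im b + complex.Im a * complex.Re b.
  by case: a; case: b.
have ReC (a : complex.complex R) : complex.Re (Num.conj a) = complex.Re a.
  by case: a.
have ImC (a : complex.complex R) : complex.Im (Num.conj a) = - complex.Im a.
  by case: a.
have PM : P *m A = diag_mx sp *m P.
  by rewrite {1}AE !mulmxA mulmxV ?mul1mx// unitarymx_unit.
have PM' k i : \sum_j P k j * inj (M j i) = inj (d k) * P k i.
  have /matrixP/(_ k i) := PM; rewrite mul_diag_mx !mxE dE => <-.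
  by apply: eq_bigr => j _; rewrite mxE.
(* Orthonormality of the columns, rather than of the rows, gives completeness. *)
have PC i j : \sum_k Num.conj (P k i) * P k j = (i == j)%:R.
  have /unitarymxP := Pu => /mulmx1C /matrixP/(_ i j); rewrite !mxE => <-.
  by apply: eq_bigr => k _; rewrite !mxE.
exists d, X, Y; split; first split.
- move=> k; rewrite /dotv -big_split /=.
  have /unitarymxP/matrixP/(_ k k) := Pu; rewrite !mxE eqxx => /(congr1 (@complex.Re R)).
  rewrite Rsum => E; apply: etrans E; apply: eq_bigr => j _.
  by rewrite !mxE ReM ReC ImC mulrN opprK.
- move=> v w.
  transitivity (\sum_k \sum_i \sum_j
     v 0 i * w 0 j * complex.Re (Num.conj (P k i) * P k j)).
    apply: eq_bigr => k _; rewrite /dotv !mulr_suml -big_split /=.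
    apply: eq_bigr => i _; rewrite !mulr_sumr -big_split /=.
    by apply: eq_bigr => j _; rewrite !mxE ReM ReC ImC; ring.
  rewrite exchange_big /dotv /=; apply: eq_bigr => i _.
  rewrite exchange_big /= (bigD1 i)//= [X in _ + X]big1 ?addr0 => [|j ji].
    by rewrite -mulr_sumr -Rsum PC eqxx mulr1.
  by rewrite -mulr_sumr -Rsum PC eq_sym (negbTE ji) mulr0.
- move=> k; apply/rowP => i; rewrite !mxE.
  have /(congr1 (@complex.Re R)) := PM' k i.
  rewrite Rsum ReM /= mul0r subr0 => <-; apply: eq_bigr => j _.
  by rewrite !mxE ReM /= mulr0 subr0.
- move=> k; apply/rowP => i; rewrite !mxE.
  have /(congr1 (@complex.Im R)) := PM' k i.
  rewrite Isum ImM /= mul0r addr0 => <-; apply: eq_bigr => j _.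
  by rewrite !mxE ImM /= mulr0 add0r.
- apply: (map_poly_inj inj); rewrite map_char_poly -/A AE char_poly_similar ?unitarymx_unit//.
  rewrite char_poly_trig ?diag_mx_is_trig// rmorph_prod /=.
  apply: eq_bigr => i _; rewrite mxE eqxx mulr1n dE.
  by rewrite rmorphB /= map_polyX map_polyC.
Qed.
End Spectral.

(** * The inner product and quadratic forms *)

Section Forms.
Context {R : realType} {n : nat}.
Implicit Types (u v w : 'rV[R]_n) (M N : 'M[R]_n).

Lemma dotvC u v : dotv u v = dotv v u.
Proof. by apply: eq_bigr => i _; rewrite mulrC. Qed.

Lemma dotvDl u v w : dotv (u + v) w = dotv u w + dotv v w.
Proof. by rewrite -big_split; apply: eq_bigr => i _; rewrite mxE mulrDl. Qed.

Lemma dotvZl (a : R) u v : dotv (a *: u) v = a * dotv u v.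
Proof. by rewrite mulr_sumr; apply: eq_bigr => i _; rewrite mxE mulrA. Qed.

Lemma dotvNl u v : dotv (- u) v = - dotv u v.
Proof. by rewrite -scaleN1r dotvZl mulN1r. Qed.

Lemma dotvBl u v w : dotv (u - v) w = dotv u w - dotv v w.
Proof. by rewrite dotvDl dotvNl. Qed.

Lemma dotvDr u v w : dotv w (u + v) = dotv w u + dotv w v.
Proof. by rewrite dotvC dotvDl !(dotvC w). Qed.

Lemma dotvZr (a : R) u v : dotv u (a *: v) = a * dotv u v.
Proof. by rewrite dotvC dotvZl dotvC. Qed.

Lemma dotvNr u v : dotv u (- v) = - dotv u v.
Proof. by rewrite dotvC dotvNl dotvC. Qed.

Lemma dotvBr u v w : dotv w (u - v) = dotv w u - dotv w v.
Proof. by rewrite dotvDr dotvNr. Qed.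

Lemma dotv0l u : dotv 0 u = 0.
Proof. by rewrite -(scale0r 0) dotvZl mul0r. Qed.

Lemma dotv_ge0 v : 0 <= dotv v v.
Proof. by apply: sumr_ge0 => i _; rewrite -expr2 sqr_ge0. Qed.

Lemma dotv_eq0 v : (dotv v v == 0) = (v == 0).
Proof.
apply/eqP/eqP => [|->]; last exact: dotv0l.
move/eqP; rewrite psumr_eq0; last by move=> i _; rewrite -expr2 sqr_ge0.
move=> /allP v0; apply/rowP => i; rewrite mxE.
by have /eqP := v0 i (mem_index_enum i); rewrite -expr2 => /eqP; rewrite sqrf_eq0 => /eqP.
Qed.

Lemma dotv_gt0 v : v != 0 -> 0 < dotv v v.
Proof. by move=> v0; rewrite lt_def dotv_eq0 v0 dotv_ge0. Qed.

Lemma dotv_add_le (x y : 'rV[R]_n) : dotv (x + y) (x + y) <= 2 * dotv x x + 2 * dotv y y.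
Proof.
have := dotv_ge0 (x - y).
by rewrite !dotvBl !dotvBr !dotvDl !dotvDr (dotvC y x); lra.
Qed.

Lemma dotv_mulmx M u v : dotv u (v *m M) = dotv (u *m M^T) v.
Proof.
rewrite /dotv; under eq_bigr do rewrite mxE mulr_sumr.
rewrite exchange_big /=; apply: eq_bigr => i _; rewrite mxE mulr_suml.
by apply: eq_bigr => j _; rewrite mxE; ring.
Qed.

Lemma dotv_deltal (i : 'I_n) v : dotv (delta_mx 0 i) v = v 0 i.
Proof.
rewrite /dotv (bigD1 i)//= big1 => [|j ji]; rewrite !mxE ?eqxx ?mul1r ?addr0//.
by rewrite (negbTE ji) mul0r.
Qed.

Definition qform M v : R := dotv v (v *m M).

Lemma qformD M N v : qform (M + N) v = qform M v + qform N v.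
Proof. by rewrite /qform mulmxDr dotvDr. Qed.

Lemma qformZ (a : R) M v : qform (a *: M) v = a * qform M v.
Proof. by rewrite /qform -scalemxAr dotvZr. Qed.

Lemma qformB M N v : qform (M - N) v = qform M v - qform N v.
Proof. by rewrite qformD -scaleN1r qformZ mulN1r. Qed.

Lemma qform1 v : qform 1%:M v = dotv v v.
Proof. by rewrite /qform mulmx1. Qed.

Lemma qform_scale (a : R) M v : qform M (a *: v) = a ^+ 2 * qform M v.
Proof. by rewrite /qform -scalemxAl dotvZl dotvZr mulrA expr2. Qed.

Lemma qform_delta M (i : 'I_n) : qform M (delta_mx 0 i) = M i i.
Proof. by rewrite /qform dotv_deltal -rowE mxE. Qed.

Lemma qform_rank1 u v : qform (u^T *m u) v = dotv v u ^+ 2.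
Proof.
rewrite /qform mulmxA (_ : v *m u^T = (dotv v u)%:M); last first.
  by apply/rowP => i; rewrite !ord1 !mxE eqxx mulr1n; apply: eq_bigr => j _; rewrite mxE.
by rewrite mul_scalar_mx dotvZr expr2.
Qed.

End Forms.

Section Resolution.
Context {R : realType} {n : nat}.
Variables (M : 'M[R]_n) (d : 'I_n -> R) (X Y : 'I_n -> 'rV[R]_n).
Hypotheses (Msym : M^T = M) (spM : spectral_resolution M d X Y).

(* The trace of [N] against the real part of the spectral projection [k]. *)
Definition component (Z T : 'rV[R]_n) (N : 'M[R]_n) : R := qform N Z + qform N T.

Lemma resolution_qform v :
  qform M v = \sum_k d k * (dotv v (X k) ^+ 2 + dotv v (Y k) ^+ 2).
Proof.
have [_ full XM YM] := spM.
have E u : dotv (v *m M) u = dotv v (u *m M) by rewrite dotv_mulmx Msym.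
rewrite /qform -full; apply: eq_bigr => k _.
by rewrite !E XM YM !dotvZr; ring.
Qed.

Lemma resolution_component k : component (X k) (Y k) M = d k.
Proof.
have [norm1 _ XM YM] := spM.
by rewrite /component /qform XM YM !dotvZr -mulrDr norm1 mulr1.
Qed.

Lemma resolution_trace : \sum_k d k = \sum_i M i i.
Proof.
under [RHS]eq_bigr do rewrite -qform_delta resolution_qform.
rewrite exchange_big /=; apply: eq_bigr => k _.
rewrite -mulr_sumr -[LHS]mulr1; congr (_ * _).
have [norm1 _ _ _] := spM; rewrite -(norm1 k) -big_split /=.
by apply: eq_bigr => i _; rewrite !dotv_deltal !expr2.
Qed.

Lemma resolution_gt0 k : (forall v, v != 0 -> 0 < qform M v) -> 0 < d k.
Proof.
move=> Mpos; rewrite -resolution_component /component.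
have [norm1 _ _ _] := spM; have := norm1 k.
have M0 v : 0 <= qform M v.
  have [->|v0] := eqVneq v 0; last exact/ltW/Mpos.
  by rewrite /qform dotv0l.
have [->|X0 _] := eqVneq (X k) 0; last by rewrite ltr_pwDl// Mpos.
have [->|Y0 _] := eqVneq (Y k) 0; last by rewrite ltr_wpDl// Mpos.
by rewrite dotv0l addr0 => /esym/eqP; rewrite oner_eq0.
Qed.

End Resolution.

Section Klein.
Context {R : realType} {n : nat}.
Variables (M N : 'M[R]_n) (d e : 'I_n -> R) (X Y Z T : 'I_n -> 'rV[R]_n).
Hypotheses (Msym : M^T = M) (spM : spectral_resolution M d X Y).
Hypotheses (Nsym : N^T = N) (spN : spectral_resolution N e Z T).

(* Klein's inequality: with [c i j] the (doubly stochastic) overlaps of the two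
   eigenbases, both sides are averages of the tangent-line inequality. *)
Lemma trace_tangent_le (f df : R -> R) :
  (forall i j, f (e j) - f (d i) <= df (d i) * (e j - d i)) ->
  \sum_j f (e j) - \sum_i f (d i) <=
  \sum_i df (d i) * component (X i) (Y i) (N - M).
Proof.
move=> tangent.
have [nX fX _ _] := spM; have [nZ fZ _ _] := spN.
pose c i j := dotv (X i) (Z j) ^+ 2 + dotv (X i) (T j) ^+ 2 +
              (dotv (Y i) (Z j) ^+ 2 + dotv (Y i) (T j) ^+ 2).
have c0 i j : 0 <= c i j by rewrite !addr_ge0// sqr_ge0.
have cj i : \sum_j c i j = 1.
  by rewrite big_split /= -(nX i) -!fZ.
have ci j : \sum_i c i j = 1.
  rewrite -(nZ j) -!fX -big_split /=; apply: eq_bigr => i _.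
  by rewrite /c !(dotvC (X i)) !(dotvC (Y i)); ring.
have -> : \sum_j f (e j) = \sum_i \sum_j c i j * f (e j).
  rewrite exchange_big /=; apply: eq_bigr => j _.
  by rewrite -mulr_suml ci mul1r.
rewrite -sumrB; apply: ler_sum => i _.
rewrite -[f (d i)]mul1r -(cj i) mulr_suml -sumrB.
have -> : component (X i) (Y i) (N - M) = \sum_j c i j * (e j - d i).
  under eq_bigr do rewrite mulrBr.
  rewrite sumrB -mulr_suml cj mul1r.
  rewrite /component !qformB addrACA -opprD -/(component (X i) (Y i) M).
  rewrite (resolution_component spM); congr (_ - _).
  rewrite !(resolution_qform Nsym spN) -big_split /=.
  by apply: eq_bigr => j _; rewrite /c; ring.
rewrite mulr_sumr; apply: ler_sum => j _.
rewrite -mulrBr mulrCA; exact: ler_wpM2l.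
Qed.

End Klein.

(** * The scalar profile and bounds on its derivative *)

Section Profile.
Context {R : realType}.
Variables (kappa beta : R).
Hypotheses (kappa_gt0 : 0 < kappa) (beta_gt0 : 0 < beta).

Definition profile (mu : R) : R := kappa * ln (mu / (mu + beta)).
Definition dprofile (mu : R) : R := kappa * beta / (mu * (mu + beta)).

Lemma dprofile_gt0 mu : 0 < mu -> 0 < dprofile mu.
Proof. by move=> mu0; rewrite divr_gt0 ?mulr_gt0 ?addr_gt0. Qed.

Lemma profile_lt0 mu : 0 < mu -> profile mu < 0.
Proof.
move=> mu0; rewrite pmulr_rlt0// ln_lt0// divr_gt0 ?addr_gt0//=.
by rewrite ltr_pdivrMr ?addr_gt0// mul1r ltrDl.
Qed.

(** Concavity of the profile: [ln (1 + t) <= t] reduces it to a rational inequality whose defect is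
    a nonnegative multiple of [(nu - mu) ^+ 2]. *)
Lemma profile_tangent mu nu : 0 < mu -> 0 < nu ->
  profile nu - profile mu <= dprofile mu * (nu - mu).
Proof.
move=> mu0 nu0; have mb : 0 < mu + beta by rewrite addr_gt0.
have nb : 0 < nu + beta by rewrite addr_gt0.
rewrite /profile -mulrBr /dprofile -!mulrA ler_pM2l//.
rewrite -ln_div ?posrE ?divr_gt0//.
apply: le_trans (_ : nu / (nu + beta) / (mu / (mu + beta)) - 1 <= _).
  rewrite -[X in ln X](subrKC 1); apply: le_ln1Dx.
  by rewrite ltrBrDl subrr !divr_gt0.
rewrite -subr_ge0.
have -> : beta * ((mu * (mu + beta))^-1 * (nu - mu)) -
  (nu / (nu + beta) / (mu / (mu + beta)) - 1) =
  beta * (nu - mu) ^+ 2 / (mu * (mu + beta) * (nu + beta)).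
  by field; rewrite !gt_eqF.
apply: divr_ge0; first by rewrite mulr_ge0 ?sqr_ge0 ?ltW.
by rewrite ltW ?mulr_gt0.
Qed.

Lemma dprofile_component mu : 0 < mu -> 0 <= dprofile mu * mu <= kappa.
Proof.
move=> mu0; have mb : 0 < mu + beta by rewrite addr_gt0.
have -> : dprofile mu * mu = kappa * (beta / (mu + beta)).
  by rewrite /dprofile; field; rewrite !gt_eqF.
rewrite ltW; last by rewrite mulr_gt0 ?divr_gt0.
rewrite /= ler_piMr ?(ltW kappa_gt0)//.
by rewrite ler_pdivrMr// mul1r lerDr ltW.
Qed.

(** A lower bound on the profile keeps [mu / (mu + beta)] away from 0, and [dprofile mu] is at most
    [kappa / beta] times its inverse. *)
Lemma dprofile_upper mu C : 0 < mu -> - C <= profile mu ->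
  dprofile mu <= kappa / beta * expR (C / kappa).
Proof.
move=> mu0 HC; have mb : 0 < mu + beta by rewrite addr_gt0.
have H : (mu + beta) / mu <= expR (C / kappa).
  rewrite -ler_ln ?posrE ?expR_gt0 ?divr_gt0// expRK ler_pdivlMr//.
  rewrite -invf_div lnV ?posrE ?divr_gt0// mulNr lerNl mulrC.
  exact: HC.
have -> : dprofile mu = kappa / beta * ((mu + beta) / mu * (beta / (mu + beta)) ^+ 2).
  by rewrite /dprofile; field; rewrite !gt_eqF.
apply: ler_wpM2l; first by rewrite ltW ?divr_gt0.
apply: le_trans H; rewrite ler_piMr ?divr_ge0 ?(ltW mb) ?(ltW mu0)//.
rewrite expr_le1 ?divr_ge0 ?(ltW mb) ?(ltW beta_gt0)//.
by rewrite ler_pdivrMr// mul1r lerDr ltW.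
Qed.

Lemma dprofile_lower mu C : 0 < mu -> mu <= C ->
  kappa * beta / (C * (C + beta)) <= dprofile mu.
Proof.
move=> mu0 muC; have mb : 0 < mu + beta by rewrite addr_gt0.
have C0 : 0 < C := lt_le_trans mu0 muC.
apply: ler_wpM2l; first by rewrite ltW ?mulr_gt0.
rewrite lef_pV2 ?posrE ?mulr_gt0 ?addr_gt0//.
by apply: ler_pM; rewrite ?(ltW mu0) ?(ltW mb) ?lerD2r.
Qed.

End Profile.

(** * Continuity and compactness tools *)

Section Continuity.
Context {R : realType} {T : topologicalType}.
Implicit Types f h : T -> R.

Lemma ctsD f h : continuous f -> continuous h -> continuous (fun x => f x + h x).
Proof. by move=> cf ch x; exact: cvgD (cf x) (ch x). Qed.

Lemma ctsM f h : continuous f -> continuous h -> continuous (fun x => f x * h x).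
Proof. by move=> cf ch x; exact: cvgM (cf x) (ch x). Qed.

Lemma ctsN f : continuous f -> continuous (fun x => - f x).
Proof. by move=> cf x; exact: cvgN (cf x). Qed.

Lemma ctsB f h : continuous f -> continuous h -> continuous (fun x => f x - h x).
Proof. by move=> cf ch x; exact: cvgB (cf x) (ch x). Qed.

Lemma cts_sum (I : finType) (F : I -> T -> R) :
  (forall i, continuous (F i)) -> continuous (fun x => \sum_i F i x).
Proof.
by move=> cF; apply: continuous_big => //; exact: add_continuous.
Qed.

Lemma cts_dotv n (f h : T -> 'rV[R]_n) : (forall i, continuous (fun x => f x 0 i)) ->
  (forall i, continuous (fun x => h x 0 i)) -> continuous (fun x => dotv (f x) (h x)).
Proof. by move=> cf ch; apply: cts_sum => i; exact: ctsM. Qed.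

End Continuity.

Lemma cts_comp (U V W : topologicalType) (f : U -> V) (h : V -> W) :
  continuous f -> continuous h -> continuous (fun x => h (f x)).
Proof. by move=> cf ch x; exact: continuous_comp (cf x) (ch (f x)). Qed.

Section EuclideanBall.
Context {R : realType} {n : nat}.

Lemma cts_coord (i : 'I_n) : continuous (fun x : 'rV[R]_n => x 0 i).
Proof. by move=> x; exact: coord_continuous. Qed.

Lemma cts_sqdist (y : 'rV[R]_n) : continuous (fun x : 'rV[R]_n => dotv (x - y) (x - y)).
Proof.
have cc i : continuous (fun x : 'rV[R]_n => (x - y) 0 i).
  rewrite (_ : (fun x => _) = (fun x : 'rV[R]_n => x 0 i - y 0 i)).
    by apply: ctsB; [exact: cts_coord|exact: cst_continuous].
  by apply/funext => x; rewrite !mxE.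
exact: cts_dotv.
Qed.

Lemma compact_sublevel (f : 'rV[R]_n -> R) (r : R) : continuous f ->
  bounded_set [set x | f x <= r] -> compact [set x | f x <= r].
Proof.
move=> cf bf; apply: bounded_closed_compact => //.
rewrite (_ : [set x | f x <= r] = f @^-1` [set y | y <= r]) //.
apply: closed_comp; first by move=> x _; exact: cf.
exact: closed_le.
Qed.

Lemma coord_le_dotv (v : 'rV[R]_n) (i : 'I_n) : v 0 i ^+ 2 <= dotv v v.
Proof.
rewrite /dotv (bigD1 i)//= -expr2 lerDl; apply: sumr_ge0 => j _.
by rewrite -expr2 sqr_ge0.
Qed.

Lemma norm_le_coord (v : 'rV[R]_n) (C : R) : 0 <= C -> (forall i, `|v 0 i| <= C) -> `|v| <= C.
Proof.
move=> C0 HC; rewrite [leLHS]/Num.norm /= mx_normrE; apply/bigmax_leP; split => //= -[i j] _ /=.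
by rewrite ord1.
Qed.

(** Each coordinate is dominated by the Euclidean norm, so the ball is bounded in the max norm. *)
Lemma compact_sqball (y : 'rV[R]_n) (r : R) :
  compact [set x : 'rV[R]_n | dotv (x - y) (x - y) <= r].
Proof.
apply: compact_sublevel; first exact: cts_sqdist.
exists (`|y| + (`|r| + 1)); split; first exact: num_real.
move=> M HM x /= Hx; apply: ltW; apply: le_lt_trans HM.
rewrite -[x](subrK y) addrC; apply: le_trans (ler_normD _ _) _; rewrite lerD2l.
apply: norm_le_coord => [|i]; first by rewrite addr_ge0.
have := le_trans (coord_le_dotv (x - y) i) Hx => H.
have r0 : 0 <= r by apply: le_trans H; exact: sqr_ge0.
rewrite -(@ler_pXn2r _ 2) ?nnegrE ?addr_ge0// real_normK ?num_real//.
apply: le_trans H _; rewrite ger0_norm//.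
by nra.
Qed.

Lemma compact_gap (B : set 'rV[R]_n) (f : 'rV[R]_n -> R) (c : R) :
  compact B -> continuous f -> (forall x, B x -> f x < c) ->
  exists2 gam, 0 < gam & forall x, B x -> f x <= c - gam.
Proof.
move=> cB cf fc; have [B0|/nonemptyPn B0] := pselect (B !=set0); last first.
  by exists 1 => // x Bx; move: Bx; rewrite B0.
have [z zB zmax] := compact_EVT_max B0 cB (continuous_subspaceT cf).
exists (c - f z); first by rewrite subr_gt0 fc//; rewrite inE in zB.
by move=> x Bx; rewrite opprB addrC subrK zmax// inE.
Qed.

Lemma compact_lower_bound (K : set 'rV[R]_n) (f : 'rV[R]_n -> R) :
  compact K -> continuous f -> exists2 C, 0 <= C & forall x, K x -> - C <= f x.
Proof.
move=> cK cf; have [K0|/nonemptyPn K0] := pselect (K !=set0); last first.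
  by exists 0 => // x Kx; move: Kx; rewrite K0.
have [z _ zmin] := compact_EVT_min K0 cK (continuous_subspaceT cf).
exists `|f z| => // x Kx; apply: le_trans (zmin x _); last by rewrite inE.
by rewrite lerNl -normrN ler_norm.
Qed.

End EuclideanBall.

(** * Second-order calculus along lines *)

Section LineC2.
Context {R : realType} {n : nat}.
Implicit Types (f : 'rV[R]_n -> R) (g : 'rV[R]_n -> 'rV[R]_n)
  (H : 'rV[R]_n -> 'M[R]_n).

(* Second-order differentiability along all lines: all that the maximum
   principle needs, without continuity of the second derivatives. *)
Definition line_C2 f g H : Prop :=
  (forall x v, is_derive x v f (dotv v (g x))) /\
  (forall x v, is_derive x v (fun y => dotv v (g y)) (qform (H x) v)).

Lemma line_C2D f1 g1 H1 f2 g2 H2 : line_C2 f1 g1 H1 -> line_C2 f2 g2 H2 ->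
  line_C2 (fun x => f1 x + f2 x) (fun x => g1 x + g2 x) (fun x => H1 x + H2 x).
Proof.
move=> [D1 DD1] [D2 DD2]; split=> x v.
  by rewrite dotvDr; exact: is_deriveD.
under eq_fun do rewrite dotvDr.
by rewrite qformD; exact: is_deriveD.
Qed.

Lemma line_C2Z (a : R) f g H : line_C2 f g H ->
  line_C2 (fun x => a * f x) (fun x => a *: g x) (fun x => a *: H x).
Proof.
move=> [D DD]; split=> x v.
  by rewrite dotvZr; exact: is_deriveZ.
under eq_fun do rewrite dotvZr.
by rewrite qformZ; exact: is_deriveZ.
Qed.

Lemma is_derive_dilate f (s : R) x v k :
  is_derive (s *: x) (s *: v) f k -> is_derive x v (fun y => f (s *: y)) k.
Proof.
move=> D; rewrite -(addr0 x) -(scale0r v); apply/is_derive_line.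
under eq_fun do rewrite scalerDr !scalerA mulrC -scalerA.
by apply/is_derive_line; rewrite scale0r addr0.
Qed.

Lemma line_C2_dilate (s : R) f g H : line_C2 f g H ->
  line_C2 (fun x => f (s *: x)) (fun x => s *: g (s *: x))
          (fun x => s ^+ 2 *: H (s *: x)).
Proof.
move=> [D DD]; split=> x v.
  by apply: is_derive_dilate; rewrite dotvZr -dotvZl.
under eq_fun do rewrite dotvZr -dotvZl.
apply: (@is_derive_dilate (fun z => dotv (s *: v) (g z))).
by rewrite qformZ -qform_scale.
Qed.

Lemma is_derive_linear (a : 'rV[R]_n) x v : is_derive x v (fun y => dotv y a) (dotv v a).
Proof.
rewrite -(addr0 x) -(scale0r v); apply/is_derive_line.
under eq_fun do rewrite dotvDl dotvZl.
by apply: is_derive_eq; rewrite -![_ *: _]/(_ * _); ring.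
Qed.

Lemma line_C2_affine (a : 'rV[R]_n) (c : R) :
  line_C2 (fun x => dotv x a + c) (fun=> a) (fun=> 0).
Proof.
split=> x v.
  rewrite -[dotv v a]addr0; apply: is_deriveD; exact: is_derive_linear.
by rewrite /qform mulmx0 (dotvC v 0) dotv0l; exact: is_derive_cst.
Qed.

Lemma line_C2_sqdist (y : 'rV[R]_n) :
  line_C2 (fun x => dotv (x - y) (x - y)) (fun x => 2 *: (x - y)) (fun=> 2 *: 1%:M).
Proof.
split=> x v.
  rewrite -(addr0 x) -(scale0r v); apply/is_derive_line.
  have -> : (fun s => dotv (x + s *: v - y) (x + s *: v - y)) =
    (fun s => dotv (x - y) (x - y) + s * (2 * dotv v (x - y)) + s ^+ 2 * dotv v v).
    apply/funext => s; rewrite [x + _ - y]addrAC; move: (x - y) => z.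
    by rewrite !dotvDl !dotvDr !dotvZl !dotvZr (dotvC z v); ring.
  apply: is_derive_eq; rewrite scale0r addr0 dotvZr.
  by rewrite -![_ *: _]/(_ * _); ring.
under eq_fun do rewrite dotvZr dotvC dotvBl.
rewrite qformZ qform1; apply: is_deriveZ.
rewrite -[dotv v v]subr0; apply: is_deriveB; exact: is_derive_linear.
Qed.

(** Besides the scaled Hessian, the chain rule produces the rank-one form of the gradient; this term
    drives Hopf's barrier. *)
Lemma line_C2_comp (p dp ddp : R -> R) f g H : line_C2 f g H ->
  (forall t : R, is_derive t 1 p (dp t)) -> (forall t : R, is_derive t 1 dp (ddp t)) ->
  line_C2 (fun x => p (f x)) (fun x => dp (f x) *: g x)
     (fun x => dp (f x) *: H x + ddp (f x) *: ((g x)^T *m g x)).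
Proof.
move=> [D DD] Dp Ddp.
have chain (r dr : R -> R) x v : (forall t : R, is_derive t 1 r (dr t)) ->
    is_derive x v (fun y => r (f y)) (dr (f x) * dotv v (g x)).
  move=> Dr; rewrite -(addr0 x) -(scale0r v); apply/is_derive_line.
  have Df0 : is_derive (0 : R) 1 (fun s => f (x + s *: v)) (dotv v (g (x + 0 *: v))).
    by apply/is_derive_line; exact: D.
  have := is_derive1_comp (Dr _) Df0; exact.
split=> x v; first by rewrite dotvZr; exact: chain.
under eq_fun do rewrite dotvZr.
rewrite qformD !qformZ qform_rank1.
rewrite (_ : _ + _ = dp (f x) *: qform (H x) v +
    dotv v (g x) *: (ddp (f x) * dotv v (g x))); last first.
  by rewrite -![_ *: _]/(_ * _); ring.
exact: is_deriveM (chain _ _ x v Ddp) (DD x v).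
Qed.

Lemma class_C2_line_C2 f : class_C2 f -> line_C2 f (gradient f) (hessian f).
Proof.
move=> [C1 C2]; split=> x v; first exact: class_C1_is_derive.
rewrite /dotv; under eq_fun do under eq_bigr do rewrite mxE.
have -> : qform (hessian f x) v = \sum_i v 0 i * dotv v (gradient (partial i f) x).
  rewrite /qform /dotv; apply: eq_bigr => i _; rewrite mxE; congr (_ * _).
  by apply: eq_bigr => j _; rewrite !mxE.
rewrite (_ : (fun y => _) = \sum_i (fun y => v 0 i * partial i f y)); last first.
  by apply/funext => y; rewrite fct_sumE.
apply: is_derive_sum => i; apply: is_deriveZ; exact: class_C1_is_derive.
Qed.

Lemma hessian_sym f x : class_C2 f -> (hessian f x)^T = hessian f x.
Proof. by move=> C2; apply/matrixP => i j; rewrite !mxE partial_comm. Qed.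

End LineC2.

(** * Maximum principles for the phase *)

Section Core.
Context {R : realType} {n : nat}.
Variables (kappa beta : R) (w : 'rV[R]_n -> R) (g : 'rV[R]_n -> 'rV[R]_n)
  (H : 'rV[R]_n -> 'M[R]_n) (d : 'rV[R]_n -> 'I_n -> R)
  (X Y : 'rV[R]_n -> 'I_n -> 'rV[R]_n).
Hypotheses (kappa_gt0 : 0 < kappa) (beta_gt0 : 0 < beta).
Hypotheses (w_C2 : line_C2 w g H) (w_cont : continuous w)
  (g_cont : forall i, continuous (fun x => g x 0 i))
  (H_cont : forall i, continuous (fun x => H x i i)).
Hypotheses (H_sym : forall x, (H x)^T = H x)
  (H_pos : forall x v, v != 0 -> 0 < qform (H x) v)
  (H_sp : forall x, spectral_resolution (H x) (d x) (X x) (Y x)).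

(** By Euler's identity it vanishes when [w] is homogeneous of degree 2. *)
Definition phase (x : 'rV[R]_n) : R := - w x + 1 / 2 * dotv x (g x).

Hypothesis w_eq : forall x, \sum_k profile kappa beta (d x k) = phase x.

(* The linearization at [w] of the operator [sum_k profile (d k)], applied to
   a function with Hessian [N]. *)
Definition linop (x : 'rV[R]_n) (N : 'M[R]_n) : R :=
  \sum_k dprofile kappa beta (d x k) * component (X x k) (Y x k) N.

Lemma d_gt0 x k : 0 < d x k.
Proof. exact: resolution_gt0 (H_sp x) _ (@H_pos x). Qed.

Lemma phase_cont : continuous phase.
Proof.
apply: ctsD; first exact: ctsN.
apply: ctsM; first exact: cst_continuous.
by apply: cts_dotv => // i; exact: cts_coord.
Qed.

Lemma phase_le0 x : phase x <= 0.
Proof.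
rewrite -w_eq; apply: sumr_le0 => k _.
by apply/ltW/profile_lt0 => //; exact: d_gt0.
Qed.

(** Ellipticity: the weights [dprofile] are positive. *)
Lemma linop_le x (N1 N2 : 'M[R]_n) :
  (forall v, qform N1 v <= qform N2 v) -> linop x N1 <= linop x N2.
Proof.
move=> N12; apply: ler_sum => k _; apply: ler_wpM2l.
  exact/ltW/dprofile_gt0/d_gt0.
by apply: lerD; exact: N12.
Qed.

Lemma linopZ x (a : R) N : linop x (a *: N) = a * linop x N.
Proof.
rewrite mulr_sumr; apply: eq_bigr => k _; rewrite /component !qformZ; ring.
Qed.

(** Klein's inequality for the concave profile, rewritten with the equation; it stands in for
    differentiating the equation. *)
Lemma phase_increment_le x y : phase y - phase x <= linop x (H y - H x).
Proof.
rewrite -!w_eq; apply: (trace_tangent_le (H_sp x) (H_sym y) (H_sp y)) => i j.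
by apply: profile_tangent => //; exact: d_gt0.
Qed.

(** * Blow-downs and the weak maximum principle *)

Lemma is_derive_inv_sq (s : R) : 0 < s ->
  is_derive s 1 (fun t : R => t^-1 * t^-1) (- 2 * s ^- 3).
Proof.
move=> s0.
have Dinv : is_derive s 1 (fun t : R => t^-1) (- s ^- 2).
  apply: DeriveDef; first by apply: derivableV; rewrite ?gt_eqF.
  by rewrite deriveV ?gt_eqF// derive_id -[_ *: _]/(_ * _) mulr1.
rewrite (_ : - 2 * _ = s^-1 *: - s ^- 2 + s^-1 *: - s ^- 2).
  exact: (is_deriveM Dinv Dinv).
by rewrite -![_ *: (_ : R)]/(_ * _); field; rewrite gt_eqF.
Qed.

(* The blow-down [s^-2 w (s x)] flows by the phase. *)
Lemma is_derive_blowdown x (s : R) : 0 < s ->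
  is_derive s 1 (fun t => t^-1 * t^-1 * w (t *: x)) (2 * s ^- 3 * phase (s *: x)).
Proof.
move=> s0.
have Dw : is_derive s 1 (fun t => w (t *: x)) (dotv x (g (s *: x))).
  have := (is_derive_line w 0 x s (dotv x (g (s *: x)))).1.
  rewrite add0r => /(_ (w_C2.1 _ _)).
  by under eq_fun do rewrite add0r.
rewrite (_ : 2 * _ * _ = (s^-1 * s^-1) *: dotv x (g (s *: x)) +
    w (s *: x) *: (- 2 * s ^- 3)).
  exact: is_deriveM (is_derive_inv_sq s0) Dw.
by rewrite -![_ *: (_ : R)]/(_ * _) /phase dotvZl; field; rewrite gt_eqF.
Qed.

(** At [s = 1] the blow-down moves with speed [2 * phase x], whence the factor 2 in the
    denominator. *)
Definition blowdown_quotient (s : R) (x : 'rV[R]_n) : R :=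
  (s^-1 * s^-1 * w (s *: x) - w x) / (2 * (s - 1)).

Lemma blowdown_quotientE (s : R) x : 1 < s ->
  exists2 sigma, 1 < sigma < s &
    blowdown_quotient s x = sigma ^- 3 * phase (sigma *: x).
Proof.
move=> s1.
have D (t : R) : 1 <= t -> is_derive t 1 (fun t => t^-1 * t^-1 * w (t *: x))
    (2 * t ^- 3 * phase (t *: x)).
  by move=> t1; apply: is_derive_blowdown; exact: lt_le_trans t1.
have C : {within `[1, s], continuous (fun t => t^-1 * t^-1 * w (t *: x))}.
  apply: derivable_within_continuous => t; rewrite in_itv/= => /andP[t1 _].
  by have [] := D t t1.
have [|c] := MVT s1 _ C (df := fun t => 2 * t ^- 3 * phase (t *: x)).
  by move=> t; rewrite in_itv/= => /andP[t1 _]; exact/D/ltW.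
rewrite in_itv/= => c1s E; exists c => //.
rewrite /blowdown_quotient; rewrite !invr1 !mul1r scale1r in E.
by rewrite E; field; rewrite subr_eq0 !gt_eqF// (lt_trans ltr01)//; case/andP: c1s.
Qed.

(** The first estimate controls the quotient in the form given by [blowdown_quotientE]; the second
    serves the critical point identity in [phase_weak_max]. Compactness makes both limits at
    [sigma = 1] uniform. *)
Lemma phase_dilation_near (K : set 'rV[R]_n) (e : R) : compact K -> 0 < e ->
  exists2 s, 1 < s & forall sigma x, 1 < sigma <= s -> K x ->
    `|sigma ^- 3 * phase (sigma *: x) - phase x| < e /\
    `|(sigma + 1) / sigma ^+ 2 * phase (sigma *: x) - 2 * phase x| < e.
Proof.
move=> /compact_near_coveringP cK e0.
pose P (sigma : R) x := `|sigma ^- 3 * phase (sigma *: x) - phase x| < e /\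
    `|(sigma + 1) / sigma ^+ 2 * phase (sigma *: x) - 2 * phase x| < e.
have HP x : K x -> \forall x' \near x & sigma \near (1 : R), P sigma x'.
  move=> _.
  have cs : z.2 @[z --> (x, 1 : R)] --> (1 : R) by exact: cvg_snd.
  have cp : phase z.1 @[z --> (x, 1 : R)] --> phase x.
    by apply: continuous_cvg; [exact: phase_cont|exact: cvg_fst].
  have cph : phase (z.2 *: z.1) @[z --> (x, 1 : R)] --> phase x.
    apply: continuous_cvg; first exact: phase_cont.
    by rewrite -[X in _ --> X]scale1r; apply: cvgZ => //; exact: cvg_fst.
  have cX k : z.2 ^+ k @[z --> (x, 1 : R)] --> (1 : R).
    rewrite -[X in _ --> X](expr1n R k).
    exact: (continuous_cvg _ (@exprn_continuous R k 1) cs).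
  have cV k : z.2 ^- k @[z --> (x, 1 : R)] --> (1 : R).
    by rewrite -[X in _ --> X]invr1; apply: cvgV => //; rewrite oner_neq0.
  have c1 : z.2 ^- 3 * phase (z.2 *: z.1) - phase z.1 @[z --> (x, 1 : R)] --> (0 : R).
    rewrite -(subrr (phase x)) -[X in X - _]mul1r; apply: cvgB => //.
    exact: cvgM.
  have c2 : (z.2 + 1) / z.2 ^+ 2 * phase (z.2 *: z.1) - 2 * phase z.1
      @[z --> (x, 1 : R)] --> (0 : R).
    rewrite -(subrr (2 * phase x)) -[X in X * _ - _]mulr1; apply: cvgB.
      apply: cvgM => //; apply: cvgM => //.
      by apply: cvgD => //; exact: cvg_cst.
    by apply: cvgM => //; exact: cvg_cst.
  move/cvgrPdist_lt: c1 => /(_ _ e0) c1; move/cvgrPdist_lt: c2 => /(_ _ e0) c2.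
  apply: filterS2 c1 c2 => z /= h1 h2.
  by rewrite sub0r normrN in h2; rewrite sub0r normrN in h1.
have HK : nbhs (1 : R) [set s | K `<=` P s] by exact: cK HP.
have [r /= r0 Hr] := (nbhs_ballP _ _).1 HK.
exists (1 + r / 2); first by rewrite ltrDl divr_gt0.
move=> sigma x /andP[s1 s2] Kx; apply: (Hr sigma) => //.
rewrite -ball_normE /= distrC gtr0_norm ?subr_gt0// ltrBlDl.
by apply: le_lt_trans s2 _; rewrite ltrD2l ltr_pdivrMr// ltr_pMr// ltr1n.
Qed.

(* Weak maximum principle.  As [w] is only C^2, the equation cannot be
   differentiated: [phase] is replaced by [blowdown_quotient s], which converges
   to it as [s -> 1] and for which concavity gives a differential inequality. *)
Lemma phase_weak_max (q psi : 'rV[R]_n -> R) gpsi Hpsi (delta : R) p :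
  continuous q -> continuous psi -> line_C2 psi gpsi Hpsi ->
  compact [set x | q x <= 0] -> 0 < delta ->
  (forall x, q x < 0 -> linop x (Hpsi x) - 1 / 2 * dotv x (gpsi x) <= - delta) ->
  q p <= 0 ->
  exists2 y, q y = 0 & phase p - psi p <= phase y - psi y.
Proof.
move=> cq cpsi psiC2 cK delta0 Lpsi qp; apply: contrapT => noy.
pose K := [set x | q x <= 0]; pose B := [set x | q x = 0].
pose m x := phase x - psi x.
have cm : continuous m by apply: ctsB => //; exact: phase_cont.
have cB : compact B.
  apply: subclosed_compact cK _; last by move=> x /= ->.
  apply: (@closed_comp _ _ q [set 0]); first by move=> x _; exact: cq.
  exact: closed_eq.
have mB y : B y -> m y < m p.
  by move=> By; rewrite ltNge; apply/negP => mpy; apply: noy; exists y.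
have [gam gam0 Hgam] := compact_gap cB cm mB.
(* The bound [gam / 4] will exclude a boundary maximum of the perturbed function; [delta / 2] will
   contradict [Lpsi] at an interior one. *)
pose e := Num.min (gam / 4) (delta / 2).
have e0 : 0 < e by rewrite lt_min !divr_gt0.
have eg : e <= gam / 4 by rewrite ge_min lexx.
have ed : e <= delta / 2 by rewrite ge_min lexx orbT.
have [s s1 Hs] := phase_dilation_near cK e0.
have s0 : 0 < s := lt_trans ltr01 s1.
have bq x : K x -> `|blowdown_quotient s x - phase x| < e.
  move=> Kx; have [sig /andP[sig1 sigs] ->] := blowdown_quotientE x s1.
  by have [] := Hs sig x _ Kx; rewrite ?sig1 ?(ltW sigs).
pose h x := blowdown_quotient s x - psi x.
have ch : continuous h.
  apply: ctsB => //; apply: ctsM; last exact: cst_continuous.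
  apply: ctsB => //; apply: ctsM; first exact: cst_continuous.
  apply: (@cts_comp _ _ _ (fun x : 'rV[R]_n => s *: x)) => //.
  exact: scaler_continuous.
have Kp : K !=set0 by exists p.
have [z zK zmax] := compact_EVT_max Kp cK (continuous_subspaceT ch).
rewrite inE in zK.
have hz y : K y -> h y <= h z by move=> Ky; apply: zmax; rewrite inE.
have qz : q z < 0.
  rewrite lt_neqAle; apply/andP; split; last exact: zK.
  apply/eqP => /Hgam; rewrite /m => Hz.
  have := bq _ zK; have := bq _ qp; have := hz _ qp.
  rewrite /h !ltr_norml => ? /andP[? ?] /andP[? ?]; lra.
pose c := (2 * (s - 1))^-1.
have c0 : 0 < c by rewrite invr_gt0 mulr_gt0// subr_gt0.
pose gh x := c *: (s^-1 *: g (s *: x) - g x) - gpsi x.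
pose Hh x := c *: (H (s *: x) - H x) - Hpsi x.
have hC2 : line_C2 h gh Hh.
  have C := line_C2D (line_C2Z c (line_C2D (line_C2Z (s^-1 * s^-1)
    (line_C2_dilate s w_C2)) (line_C2Z (-1) w_C2))) (line_C2Z (-1) psiC2).
  have E1 : h = (fun x => c * (s^-1 * s^-1 * w (s *: x) + -1 * w x) + -1 * psi x).
    by apply/funext => x; rewrite /h /blowdown_quotient !mulN1r [in RHS]mulrC.
  have E2 : gh = (fun x => c *: ((s^-1 * s^-1) *: (s *: g (s *: x)) + -1 *: g x)
      + -1 *: gpsi x).
    by apply/funext => x; rewrite /gh !scaleN1r scalerA mulfVK ?gt_eqF.
  have E3 : Hh = (fun x => c *: ((s^-1 * s^-1) *: (s ^+ 2 *: H (s *: x)) + -1 *: H x)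
      + -1 *: Hpsi x).
    apply/funext => x; rewrite /Hh !scaleN1r scalerA -expr2 exprVn mulVf ?scale1r//.
    by rewrite expf_neq0 ?gt_eqF.
  by rewrite E1 E2 E3.
have crit v : dotv v (gh z) = 0 /\ qform (Hh z) v <= 0.
  have D (t : R) : is_derive t 1 (fun r => h (z + r *: v)) (dotv v (gh (z + t *: v))).
    by apply/is_derive_line; exact: hC2.1.
  have D2 : is_derive (0 : R) 1 (fun r => dotv v (gh (z + r *: v)))
      (qform (Hh z) v).
    apply: (@is_derive_line _ _ (fun y => dotv v (gh y)) z v 0 _).1.
    by rewrite scale0r addr0; exact: hC2.2.
  have [] := second_derivative_test D D2; last by rewrite scale0r addr0.
  have cqv : continuous (fun r : R => q (z + r *: v)).
    by apply: (@cts_comp _ _ _ (fun r : R => z + r *: v)) => //; exact: continuous_line.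
  have : \forall r \near (0 : R), q (z + r *: v) < 0.
    by have := cvgr_lt _ (cqv 0) 0; rewrite scale0r addr0; apply.
  apply: filterS => r qr; rewrite scale0r addr0; apply: hz.
  exact: ltW.
(* Concavity bounds the difference of phases, and the Hessian inequality at the maximum passes from
   the quotient to [psi]. *)
have Hcmp : c * (phase (s *: z) - phase z) <= linop z (Hpsi z).
  apply: le_trans (_ : linop z (c *: (H (s *: z) - H z)) <= _).
    by rewrite linopZ ler_pM2l// phase_increment_le.
  apply: linop_le => v; rewrite -subr_le0 -qformB.
  exact: (crit v).2.
(* The gradient is tested in the radial direction, where it is expressible by [phase] and [w]; the
   values of [w] recombine into the quotient. *)
have := (crit z).1; rewrite /gh dotvBr dotvZr dotvBr dotvZr.
have -> : dotv z (g (s *: z)) = s^-1 * (2 * (phase (s *: z) + w (s *: z))).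
  by rewrite /phase dotvZl; field; rewrite gt_eqF.
have -> : dotv z (g z) = 2 * (phase z + w z) by rewrite /phase; field.
move=> crit0.
have := Lpsi z qz.
have [H1 H2] := Hs s z ltac:(by rewrite s1 lexx) zK.
have := bq _ zK; move: H1 H2 crit0 Hcmp; rewrite !ltr_norml /blowdown_quotient -/c.
set A := phase (s *: z); set W := w (s *: z); set P := phase z.
move=> _ /andP[H2 _] crit0 Hcmp /andP[_ H3] H4.
(* After [c * P] cancels, this multiple of [A] remains; it is close to [2 * P], as is twice the
   quotient, which leaves no room for [delta]. *)
have E1 : (s + 1) / s ^+ 2 * A = 2 * (c * (A - s^-1 * s^-1 * A)).
  by rewrite /c; field; rewrite ?subr_eq0 !gt_eqF.
rewrite {}E1 in H2.
move: H2 H3 H4 Hcmp crit0; lra.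
Qed.

(** * The convex barrier at infinity and existence of a maximum *)

Definition osc (x : 'rV[R]_n) : R := w x + (dotv x (- g 0) + - w 0).

Lemma osc_C2 : line_C2 osc (fun x => g x - g 0) H.
Proof.
have := line_C2D w_C2 (line_C2_affine (- g 0) (- w 0)).
rewrite (_ : (fun x => H x + 0) = H)//.
by apply/funext => x; rewrite addr0.
Qed.

Lemma osc0 : osc 0 = 0.
Proof. by rewrite /osc dotv0l add0r subrr. Qed.

Lemma osc_cont : continuous osc.
Proof.
apply: ctsD => //; apply: ctsD; last exact: cst_continuous.
by apply: cts_dotv => i; [exact: cts_coord|exact: cst_continuous].
Qed.

Lemma osc_ray_slope x (s t : R) : s <= t ->
  dotv x (g (s *: x) - g 0) <= dotv x (g (t *: x) - g 0).
Proof.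
move=> st; have [->|x0] := eqVneq x 0; first by rewrite !dotv0l.
rewrite -subr_ge0.
have [c c01] := MVT_line (s *: x) (t - s) (fun y => osc_C2.2 y x).
rewrite -scalerDl [s + (t - s)]addrC subrK => ->.
by rewrite mulr_ge0 ?subr_ge0// ltW// H_pos.
Qed.

Lemma osc_ray x (s t : R) : exists2 c, 0 < c < 1 &
  osc (t *: x) - osc (s *: x) = (t - s) *
    dotv x (g ((s + c * (t - s)) *: x) - g 0).
Proof.
have [c c01] := MVT_line (s *: x) (t - s) (fun y => osc_C2.1 y x).
by rewrite -!scalerDl [s + (t - s)]addrC subrK => E; exists c.
Qed.

(** By convexity the slope at [x] dominates the mean slope from the origin. This lets the drift term
    outweigh [linop x (H x)] far out. *)
Lemma osc_le_radial x : osc x <= dotv x (g x - g 0).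
Proof.
have [c /andP[c0 c1]] := osc_ray x 0 1; rewrite scale0r osc0 !subr0 scale1r !mul1r => ->.
by have := osc_ray_slope x (ltW c1); rewrite add0r mulr1 scale1r.
Qed.

Lemma osc_gt0 x : x != 0 -> 0 < osc x.
Proof.
move=> x0.
have [c /andP[c0 c1]] := osc_ray x 0 1; rewrite scale0r osc0 !subr0 scale1r !mul1r => ->.
rewrite add0r mulr1.
have [c' _] := MVT_line 0 c (fun y => osc_C2.2 y x).
rewrite add0r subrr [dotv x 0]dotvC dotv0l subr0 => ->.
by rewrite mulr_gt0// H_pos.
Qed.

(** The mean slopes on [[0, t]] and [[t, 1]] are ordered by convexity. *)
Lemma osc_contract x (t : R) : 0 < t <= 1 -> osc (t *: x) <= t * osc x.
Proof.
move=> /andP[t0 t1].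
have [c /andP[c0 c1]] := osc_ray x 0 t.
rewrite scale0r osc0 !subr0 add0r => E1.
have [c' /andP[c'0 c'1]] := osc_ray x t 1; rewrite scale1r => E2.
have : (1 - t) * dotv x (g ((c * t) *: x) - g 0) <=
       (1 - t) * dotv x (g ((t + c' * (1 - t)) *: x) - g 0).
  apply: ler_wpM2l; first by rewrite subr_ge0.
  apply: osc_ray_slope; apply: (@le_trans _ _ t).
    by rewrite ler_piMl ?(ltW c1) ?(ltW t0).
  by rewrite lerDl mulr_ge0 ?subr_ge0 ?(ltW c'0).
rewrite -E2 => /(ler_wpM2l (ltW t0)); rewrite mulrCA -E1; nra.
Qed.

(** On the unit sphere [osc] is at least some [m > 0]; [osc_contract] turns this into growth at
    least [m] times the norm outside the unit ball. *)
Lemma compact_osc_sublevel r : compact [set x | osc x <= r].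
Proof.
pose S := [set x : 'rV[R]_n | dotv x x = 1].
have cN : continuous (fun x : 'rV[R]_n => dotv x x).
  by apply: cts_dotv => i; exact: cts_coord.
have cB := @compact_sqball R n 0.
have cS : compact S.
  apply: subclosed_compact (cB 1) _; last by move=> x /=; rewrite subr0 => ->.
  apply: (@closed_comp _ _ (fun x : 'rV[R]_n => dotv x x) [set 1]).
    by move=> x _; exact: cN.
  exact: closed_eq.
have [m m0 Hm] := compact_gap (f := fun x => - osc x) (c := 0) cS
  (ctsN osc_cont) ltac:(by move=> x /= x1; rewrite oppr_lt0 osc_gt0// -dotv_eq0 x1 oner_eq0).
(* The summand 1 places [x] outside the unit ball, so that [l^-1 <= 1] in the contraction. *)
apply: subclosed_compact (cB (1 + (r / m) ^+ 2)) _.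
  apply: (@closed_comp _ _ osc [set y | y <= r]); last exact: closed_le.
  by move=> x _; exact: osc_cont.
move=> x /= xr; rewrite subr0; rewrite leNgt; apply/negP => xbig.
have N0 : 1 < dotv x x by apply: le_lt_trans xbig; rewrite lerDl sqr_ge0.
pose l := Num.sqrt (dotv x x).
have lsq : l ^+ 2 = dotv x x by rewrite sqr_sqrtr// dotv_ge0.
have l0 : 0 < l by rewrite sqrtr_gt0 (lt_trans ltr01).
have l1 : 1 <= l by rewrite -sqrtr1 ler_wsqrtr// ltW.
have y1 : S (l^-1 *: x).
  by rewrite /S /= dotvZl dotvZr -lsq; field; rewrite gt_eqF.
have := Hm _ y1; rewrite sub0r lerN2 => mle.
have := @osc_contract x l^-1; rewrite invr_gt0 l0 invf_le1// l1 => /(_ isT) H1.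
have H2 : l * m <= r.
  apply: le_trans xr; rewrite -ler_pdivlMl//.
  exact: le_trans mle H1.
have H3 : l <= r / m by rewrite ler_pdivlMr.
move: xbig; rewrite ltNge => /negP; apply.
rewrite -lsq; apply: le_trans (_ : (r / m) ^+ 2 <= _); last by rewrite lerDr ler01.
rewrite ler_pXn2r ?nnegrE ?(ltW l0)//; apply: le_trans H3; exact: ltW.
Qed.

Lemma linop_H x : linop x (H x) <= n%:R * kappa.
Proof.
rewrite /linop; apply: (@le_trans _ _ (\sum_(k < n) kappa)); last first.
  by rewrite sumr_const card_ord mulr_natl.
apply: ler_sum => k _; rewrite (resolution_component (H_sp x)).
by have /andP[] := dprofile_component kappa_gt0 beta_gt0 (d_gt0 x k).
Qed.

(* The convex, proper function [osc] is a barrier at infinity, which confines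
   the maximum of the bounded-above function [phase] to a compact set. *)
Lemma phase_max_attained : exists z, forall x, phase x <= phase z.
Proof.
(* With this threshold, [n%:R * kappa - osc y / 2 <= -1] wherever [C0 <= osc y]. *)
pose C0 := 2 * (n%:R * kappa) + 2.
have C00 : 0 < C0 by rewrite /C0 ltr_wpDl// mulr_ge0// mulr_ge0 ?ler0n// ltW.
have K0 : [set x | osc x <= C0] !=set0 by exists 0; rewrite /= osc0 ltW.
have [z zK zmax] := compact_EVT_max K0 (@compact_osc_sublevel C0)
  (continuous_subspaceT phase_cont).
exists z => x; rewrite leNgt; apply/negP => zx.
have xC0 : C0 < osc x.
  by rewrite ltNge; apply/negP => xC; move: zx; rewrite ltNge zmax// inE.
have ox0 : 0 < osc x := lt_trans C00 xC0.
(* Only half of the gap is spent: [phase - e * osc] still exceeds [phase z] at [x]. *)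
pose e := (phase x - phase z) / (2 * osc x).
have e0 : 0 < e by rewrite divr_gt0 ?subr_gt0// mulr_gt0.
have eo : phase z < phase x - e * osc x.
  have -> : e * osc x = (phase x - phase z) / 2 by rewrite /e; field; rewrite gt_eqF.
  move: zx; lra.
(* As [phase <= 0], this level ensures [phase - e * osc <= phase z] on [osc = r]. *)
pose r := osc x + (- phase z) / e.
have xr : osc x <= r.
  by rewrite /r lerDl divr_ge0 ?(ltW e0)// oppr_ge0 phase_le0.
have er : - (e * r) <= phase z.
  have -> : e * r = e * osc x - phase z by rewrite /r; field; rewrite gt_eqF.
  by rewrite opprB gerDl oppr_le0 mulr_ge0 ?ltW.
(* The product encodes the shell [C0 <= osc <= r]; its zeros are the two bounding levels. *)
pose q y := (osc y - C0) * (osc y - r).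
have cq : continuous q.
  by apply: ctsM; apply: ctsB => //; try exact: osc_cont; exact: cst_continuous.
have qr y : q y <= 0 -> C0 <= osc y <= r.
  have : C0 < r := lt_le_trans xC0 xr.
  rewrite /q; set o := osc y => Cr qy; apply/andP; split; rewrite leNgt; apply/negP => ?; nra.
have cK : compact [set y | q y <= 0].
  apply: subclosed_compact (@compact_osc_sublevel r) _; last first.
    by move=> y /= /qr/andP[].
  apply: (@closed_comp _ _ q [set t | t <= 0]); last exact: closed_le.
  by move=> y _; exact: cq.
have qx : q x <= 0.
  by rewrite /q mulr_ge0_le0// ?subr_ge0 ?subr_le0// ltW.
have cpsi : continuous (fun y => e * osc y).
  by apply: ctsM; [exact: cst_continuous|exact: osc_cont].
have Lq y : q y < 0 -> linop y (e *: H y) - 1 / 2 * dotv y (e *: (g y - g 0)) <= - e.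
  move=> qy; have /andP[Cy _] := qr y (ltW qy).
  rewrite linopZ dotvZr.
  have H1 := ler_wpM2l (ltW e0) (linop_H y).
  have H2 := ler_wpM2l (ltW e0) (le_trans Cy (osc_le_radial y)).
  move: H1 H2; rewrite /C0; set A := n%:R * kappa; lra.
have [y qy] := phase_weak_max cq cpsi (line_C2Z e osc_C2) cK e0 Lq qx.
move=> H1; have H2 := lt_le_trans eo H1.
move/eqP: qy; rewrite mulf_eq0 !subr_eq0 => /orP[/eqP oy|/eqP oy].
  have := zmax y; rewrite inE /= oy lexx => /(_ isT) yz.
  have := mulr_gt0 e0 C00; rewrite oy in H2; move: H2 yz; lra.
have := phase_le0 y; rewrite oy in H2; move: H2 er; lra.
Qed.

(** * Hopf's barrier and the strong maximum principle *)

Lemma linop1 x : linop x 1%:M = \sum_k dprofile kappa beta (d x k).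
Proof.
apply: eq_bigr => k _; have [X1 _ _ _] := H_sp x.
by rewrite /component !qform1 X1 mulr1.
Qed.

(** The trace bounds each eigenvalue from above. All profile terms are negative, so each is at least
    [phase], which keeps the eigenvalues away from 0. *)
Lemma dprofile_bounds (K : set 'rV[R]_n) : compact K -> exists c C, [/\ 0 < c, 0 < C &
  forall x k, K x -> c <= dprofile kappa beta (d x k) <= C].
Proof.
move=> cK.
have [C C0 HC] := compact_lower_bound cK phase_cont.
have ctr : continuous (fun x => - \sum_i H x i i) by apply: ctsN; exact: cts_sum.
have [T T0 HT] := compact_lower_bound cK ctr.
have T1 : 0 < T + 1 by rewrite ltr_wpDl.
exists (kappa * beta / ((T + 1) * (T + 1 + beta))), (kappa / beta * expR (C / kappa)).
split; [by rewrite divr_gt0 ?mulr_gt0// addr_gt0|by rewrite mulr_gt0 ?expR_gt0 ?divr_gt0|].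
move=> x k Kx; apply/andP; split.
  apply: dprofile_lower => //; first exact: d_gt0.
  apply: (@le_trans _ _ T); last by rewrite lerDl.
  apply: le_trans (_ : \sum_i H x i i <= _); last by rewrite -lerN2 HT.
  rewrite -(resolution_trace (H_sym x) (H_sp x)) (bigD1 k)//= lerDl.
  by apply: sumr_ge0 => j _; exact/ltW/d_gt0.
apply: dprofile_upper => //; first exact: d_gt0.
apply: le_trans (HC x Kx) _; rewrite -w_eq (bigD1 k)//= gerDl.
by apply: sumr_le0 => j _; apply/ltW/profile_lt0 => //; exact: d_gt0.
Qed.

Lemma linop_rank1_ge x (c : R) v : (forall k, c <= dprofile kappa beta (d x k)) ->
  c * dotv v v <= linop x (v^T *m v).
Proof.
move=> cd; have [_ full _ _] := H_sp x; rewrite -(full v v) mulr_sumr.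
apply: ler_sum => k _; rewrite /component !qform_rank1 !expr2.
by rewrite !(dotvC v) ler_wpM2r// addr_ge0// -expr2 sqr_ge0.
Qed.

Lemma linopD x N1 N2 : linop x (N1 + N2) = linop x N1 + linop x N2.
Proof.
rewrite -big_split; apply: eq_bigr => k _; rewrite /component !qformD /=; ring.
Qed.

(** The sign is negative because the test function is subtracted from [phase]. *)
Definition hopf (al e : R) (c x : 'rV[R]_n) : R :=
  - e * expR (- al * dotv (x - c) (x - c)).

Lemma hopf_C2 al e c : line_C2 (hopf al e c)
  (fun x => (e * al * expR (- al * dotv (x - c) (x - c))) *: (2 *: (x - c)))
  (fun x => (e * al * expR (- al * dotv (x - c) (x - c))) *: (2 *: 1%:M) +
     (- e * al ^+ 2 * expR (- al * dotv (x - c) (x - c))) *: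
       ((2 *: (x - c))^T *m (2 *: (x - c)))).
Proof.
have De (t : R) : is_derive t 1 (fun s : R => expR (- al * s)) (- al * expR (- al * t)).
  have D1 : is_derive t 1 (fun s : R => - al * s) (- al).
    rewrite -[X in is_derive _ _ _ X]mulr1; apply: is_deriveZ; exact: is_derive_id.
  by rewrite mulrC; exact: (is_derive1_comp (is_derive_expR _) D1).
apply: (line_C2_comp (p := fun t => - e * expR (- al * t))
  (dp := fun t => e * al * expR (- al * t))
  (ddp := fun t => - e * al ^+ 2 * expR (- al * t)) (line_C2_sqdist c)) => t.
  have -> : e * al * expR (- al * t) = - e * (- al * expR (- al * t)) by ring.
  exact: is_deriveZ.
have -> : - e * al ^+ 2 * expR (- al * t) = (e * al) * (- al * expR (- al * t)) by ring.
exact: is_deriveZ.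
Qed.

(** In the bracket only the rank-one term carries a factor [al], so for large [al] it beats the
    trace and drift terms away from [c]. *)
Lemma hopf_linop (al e c1 C1 C2 : R) c x : 0 <= e -> 0 <= al ->
  (forall k, c1 <= dprofile kappa beta (d x k) <= C1) ->
  - C2 <= dotv x (x - c) ->
  linop x ((e * al * expR (- al * dotv (x - c) (x - c))) *: (2 *: 1%:M) +
     (- e * al ^+ 2 * expR (- al * dotv (x - c) (x - c))) *:
       ((2 *: (x - c))^T *m (2 *: (x - c)))) -
  1 / 2 * dotv x ((e * al * expR (- al * dotv (x - c) (x - c))) *: (2 *: (x - c)))
  <= - (e * al * expR (- al * dotv (x - c) (x - c)) *
        (4 * al * c1 * dotv (x - c) (x - c) - 2 * (n%:R * C1) - C2)).
Proof.
move=> e0 al0 cC HC2; set E := expR _; set z := x - c.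
have E0 : 0 <= E by exact: expR_ge0.
have H1 : linop x 1%:M <= n%:R * C1.
  rewrite linop1 mulr_natl -[n in _ *+ n]card_ord -sumr_const; apply: ler_sum => k _.
  by have /andP[] := cC k.
have H2 := @linop_rank1_ge x c1 z (fun k => (andP (cC k)).1).
have -> : (2 *: z)^T *m (2 *: z) = 4 *: (z^T *m z).
  rewrite (_ : (2 *: z)^T = 2 *: z^T); last by rewrite linearZ.
  by rewrite -scalemxAl -scalemxAr scalerA; congr (_ *: _); ring.
rewrite linopD !linopZ !dotvZr.
set L1 := linop x 1%:M in H1 *; set L2 := linop x _ in H2 *; set D := dotv x z in HC2 *.
set G := n%:R * C1 in H1 *; set Nz := dotv z z in H2 *.
rewrite -subr_ge0.
have -> : - (e * al * E * (4 * al * c1 * Nz - 2 * G - C2)) -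
   (e * al * E * (2 * L1) + - e * al ^+ 2 * E * (4 * L2) -
    1 / 2 * (e * al * E * (2 * D))) =
   e * al * E * (4 * al * (L2 - c1 * Nz) + 2 * (G - L1) + (D + C2)).
  by field.
apply: mulr_ge0; first by rewrite !mulr_ge0.
apply: addr_ge0; last by move: HC2; lra.
apply: addr_ge0; last by rewrite mulr_ge0// subr_ge0.
by rewrite mulr_ge0 ?subr_ge0// mulr_ge0.
Qed.

(* Hopf's argument: touch the set where the maximum is attained by a ball of its
   complement, and perturb [phase] by a barrier centred at that ball. *)
Lemma phase_const z0 : (forall x, phase x <= phase z0) -> forall x, phase x = phase z0.
Proof.
move=> max y; apply/eqP; rewrite eq_le max/= leNgt; apply/negP => yM.
pose M := phase z0.
pose D x := dotv (x - y) (x - y).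
(* Cutting with a ball makes the maximum set compact without losing its points nearest to [y]. *)
pose S := [set x | phase x = M /\ D x <= D z0].
have cD : continuous D by exact: cts_sqdist.
have cS : compact S.
  apply: (@subclosed_compact _ _ _ _ (@compact_sqball _ _ y (D z0))); last by move=> x [].
  apply: closedI.
    apply: (@closed_comp _ _ phase [set M]); last exact: closed_eq.
    by move=> x _; exact: phase_cont.
  apply: (@closed_comp _ _ D [set t | t <= D z0]); last exact: closed_le.
  by move=> x _; exact: cD.
have S0 : S !=set0 by exists z0; split.
have [z zS zmin] := compact_EVT_min S0 cS (continuous_subspaceT cD).
rewrite inE in zS; have [zM zD] := zS.
have nearest x : phase x = M -> D z <= D x.
  move=> xM; have [xD|xD] := leP (D x) (D z0); first by apply: zmin; rewrite inE.
  exact: le_trans zD (ltW xD).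
(* With the midpoint as centre, the ball touches the maximum set at [z] alone; a ball centred at [y]
   might touch it elsewhere too. *)
pose c := 2^-1 *: (y + z).
pose v := z - c.
pose r := dotv v v.
have vE : y - c = - v.
  by rewrite /v opprB; apply/rowP => i; rewrite !mxE; field.
have r0 : 0 < r.
  apply: dotv_gt0; apply/eqP => v0.
  have zc : z = c by apply/eqP; rewrite -subr_eq0; apply/eqP.
  have yc : y = c by apply/eqP; rewrite -subr_eq0 vE v0 oppr0.
  by move: yM; rewrite yc -zc zM ltxx.
have touch x : dotv (x - c) (x - c) <= r -> phase x = M -> x = z.
  move=> xr xM; apply/eqP; rewrite -subr_eq0 -dotv_eq0 eq_le dotv_ge0 andbT.
  have := nearest x xM; rewrite /D.
  have -> : x - y = (x - c) + v by rewrite -[v]opprK -vE opprB addrA subrK.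
  have -> : z - y = v + v by rewrite /v; apply/rowP => i; rewrite !mxE; field.
  have -> : x - z = (x - c) - v by rewrite /v opprB addrA subrK.
  (* Parallelogram law: [|p - k|^2 = 2 |p|^2 + 2 |k|^2 - |p + k|^2 <= 0]. *)
  move: xr; rewrite /r; move: (x - c) (v) => p k.
  by rewrite !dotvBl !dotvBr !dotvDl !dotvDr (dotvC p k); lra.
(* Half the radius of the touching ball keeps this ball around [z] away from [c], where the barrier
   degenerates. *)
pose q x := dotv (x - z) (x - z) - r / 4.
have cq : continuous q by apply: ctsB; [exact: cts_sqdist|exact: cst_continuous].
have Kq : [set x | q x <= 0] = [set x | dotv (x - z) (x - z) <= r / 4].
  by apply/seteqP; split => x /=; rewrite /q subr_le0.
have cK : compact [set x | q x <= 0] by rewrite Kq; exact: compact_sqball.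
have far x : q x <= 0 -> r / 4 <= dotv (x - c) (x - c) <= 3 * r.
  rewrite /q => qx.
  have H1 := dotv_add_le (z - x) (x - c); have H2 := dotv_add_le (x - z) (z - c).
  move: H1 H2; rewrite !subrKA -/v -/r.
  rewrite -(opprB x z) dotvNl dotvNr opprK => H1 H2.
  by apply/andP; split; move: qx H1 H2 r0; lra.
have [c1 [C1 [c10 C10 HcC]]] := dprofile_bounds cK.
have cxc : continuous (fun x : 'rV[R]_n => dotv x (x - c)).
  apply: cts_dotv => i; first exact: cts_coord.
  rewrite (_ : (fun x => _) = (fun x : 'rV[R]_n => x 0 i - c 0 i)).
    by apply: ctsB; [exact: cts_coord|exact: cst_continuous].
  by apply/funext => x; rewrite !mxE.
have [C2 C20 HC2] := compact_lower_bound cK cxc.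
have nC0 : 0 <= n%:R * C1 by rewrite mulr_ge0 ?ler0n// ltW.
(* This makes the bracket in [hopf_linop] at least 1 once [dotv (x - c) (x - c)] is at least
   [r / 4]. *)
have [al al0 alE] : exists2 al, 0 < al & al * (c1 * r) = 2 * (n%:R * C1) + C2 + 1.
  exists ((2 * (n%:R * C1) + C2 + 1) / (c1 * r)).
    by rewrite divr_gt0 ?mulr_gt0// ltr_wpDl// addr_ge0// mulr_ge0.
  by rewrite divfK// gt_eqF// mulr_gt0.
(* This part of the touching ball contains no maximum point; the resulting gap [e] is also taken as
   the amplitude of the barrier. *)
pose B := [set x | dotv (x - c) (x - c) <= r /\ r / 4 <= dotv (x - z) (x - z)].
have cB : compact B.
  apply: (@subclosed_compact _ _ _ _ (@compact_sqball _ _ c r)); last by move=> x [].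
  apply: closedI.
    apply: (@closed_comp _ _ (fun x : 'rV[R]_n => dotv (x - c) (x - c)) [set t | t <= r]).
      by move=> x _; exact: cts_sqdist.
    exact: closed_le.
  apply: (@closed_comp _ _ (fun x : 'rV[R]_n => dotv (x - z) (x - z)) [set t | r / 4 <= t]).
    by move=> x _; exact: cts_sqdist.
  exact: closed_ge.
have HB x : B x -> phase x < M.
  move=> [x1 x2]; rewrite lt_neqAle max andbT; apply/eqP => xM.
  have xz := touch x x1 xM; move: x2; rewrite xz subrr dotv0l leNgt.
  by rewrite divr_gt0.
have [e e0 He] := compact_gap cB phase_cont HB.
pose E x := expR (- al * dotv (x - c) (x - c)).
pose delta := e * al * expR (- al * (3 * r)).
have delta0 : 0 < delta by rewrite !mulr_gt0 ?expR_gt0.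
have cpsi : continuous (hopf al e c).
  apply: ctsM; first exact: cst_continuous.
  apply: (@cts_comp _ _ _ (fun x : 'rV[R]_n => - al * dotv (x - c) (x - c))).
    by apply: ctsM; [exact: cst_continuous|exact: cts_sqdist].
  exact: continuous_expR.
have qz : q z <= 0 by rewrite /q subrr dotv0l sub0r oppr_le0 divr_ge0 ?ltW.
have Lq x : q x < 0 -> linop x ((e * al * E x) *: (2 *: 1%:M) +
     (- e * al ^+ 2 * E x) *: ((2 *: (x - c))^T *m (2 *: (x - c)))) -
  1 / 2 * dotv x ((e * al * E x) *: (2 *: (x - c))) <= - delta.
  move=> /ltW qx; have /andP[x1 x2] := far x qx.
  apply: le_trans (hopf_linop (ltW e0) (ltW al0) (fun k => HcC x k qx) (HC2 x qx)) _.
  rewrite lerN2 /delta -[leLHS]mulr1; apply: ler_pM => //.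
  - by rewrite !mulr_ge0 ?expR_ge0 ?ltW.
  - apply: ler_wpM2l; first by rewrite mulr_ge0 ?ltW.
    by rewrite ler_expR ler_wnM2l// oppr_le0 ltW.
  have : 4 * al * c1 * (r / 4) <= 4 * al * c1 * dotv (x - c) (x - c).
    by apply: ler_wpM2l => //; rewrite !mulr_ge0 ?ltW.
  have -> : 4 * al * c1 * (r / 4) = 2 * (n%:R * C1) + C2 + 1.
    by rewrite -alE; field.
  move: (n%:R * C1) => G; lra.
have [x qx] := phase_weak_max cq cpsi (hopf_C2 al e c) cK delta0 Lq qz.
rewrite zM /hopf !mulNr !opprK -/v -/r => H1.
have xM := max x; rewrite -/M in xM.
have E1 : 0 < e * expR (- (al * r)) by rewrite mulr_gt0 ?expR_gt0.
(* Inside the touching ball the barrier gains at most [e], which the gap cancels; outside, it is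
   smaller than at [z]. Both contradict [H1]. *)
have [xr|xr] := leP (dotv (x - c) (x - c)) r.
  have Bx : B x by split => //; move/eqP: qx; rewrite subr_eq0 => /eqP ->.
  have H2 := He x Bx.
  have : e * expR (- (al * dotv (x - c) (x - c))) <= e.
    rewrite ler_piMr ?(ltW e0)// -expR0 ler_expR oppr_le0.
    by rewrite mulr_ge0 ?dotv_ge0 ?(ltW al0).
  move: H1 H2 E1; lra.
have : e * expR (- (al * dotv (x - c) (x - c))) < e * expR (- (al * r)).
  by rewrite ltr_pM2l// ltr_expR ltrN2 ltr_pM2l.
by move: H1 xM; lra.
Qed.

(* A constant phase makes [w - w 0] homogeneous of degree 2 on rays, hence equal
   to its second-order Taylor polynomial at the origin. *)
Lemma core_quadratic x : w x = w 0 + 1 / 2 * qform (H 0) x.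
Proof.
have [z zmax] := phase_max_attained.
have ph y : phase y = - w 0.
  rewrite (phase_const zmax) -(phase_const zmax 0) /phase.
  by rewrite dotv0l mulr0 addr0.
(* Constancy of the phase makes [r^-1 * r^-1 * (w (r *: x) - w 0)] independent of [r > 0]. *)
have scaling t : 0 < t -> w (t *: x) - w 0 = t ^+ 2 * (w x - w 0).
  move=> t0.
  have D (r : R) : 0 < r ->
      is_derive r 1 (fun r => r^-1 * r^-1 * w (r *: x) - w 0 * (r^-1 * r^-1)) 0.
    move=> r0; rewrite (_ : 0 = 2 * r ^- 3 * phase (r *: x) - w 0 *: (- 2 * r ^- 3)).
      exact: is_deriveB (is_derive_blowdown x r0) (is_deriveZ _ (is_derive_inv_sq r0)).
    by rewrite ph -[_ *: _]/(_ * _); ring.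
  have := constant_pos D t0 ltr01; rewrite invr1 scale1r !mul1r !mulr1 => <-.
  by field; rewrite gt_eqF.
(* The radial derivative is linear for [t > 0], and its derivative at 0 is [qform (H 0) x];
   comparing the two determines [w x]. *)
have slope t : 0 < t -> dotv x (g (0 + t *: x)) = 2 * (w x - w 0) * t.
  move=> t0; have := ph (t *: x); rewrite /phase dotvZl add0r => E.
  have -> : dotv x (g (t *: x)) = 2 * (w (t *: x) - w 0) / t.
    have -> : w (t *: x) - w 0 = 1 / 2 * (t * dotv x (g (t *: x))) by lra.
    by field; rewrite gt_eqF.
  by rewrite scaling//; field; rewrite gt_eqF.
have D : is_derive (0 : R) 1 (fun t => dotv x (g (0 + t *: x))) (qform (H 0) x).
  apply: (@is_derive_line _ _ (fun y => dotv x (g y)) 0 x 0 _).1.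
  by rewrite scale0r addr0; exact: w_C2.2.
rewrite (is_derive0_right D slope); lra.
Qed.

End Core.

(** * Reduction to the normalized equation *)

Section Reduction.
Context {R : realType} {n : nat}.

Lemma quadratic_polynomial_qform (A : 'M[R]_n) (c : R) (f : 'rV[R]_n -> R) :
  (forall x, f x = c + 1 / 2 * qform A x) -> quadratic_polynomial f.
Proof.
move=> fE.
pose x_ (i : 'I_n) : mpoly n R := mpolyX R (mnm1 i).
pose p : mpoly n R :=
  mpolyC n c + \sum_i \sum_j (1 / 2 * A j i) *: (x_ i * x_ j).
exists p; split.
  apply: leq_trans (msizeD_le _ _) _; rewrite geq_max msizeC; apply/andP; split.
    by case: eqP.
  apply: leq_trans (msize_sum _ _ _) _; apply/bigmax_leqP => i _.
  apply: leq_trans (msize_sum _ _ _) _; apply/bigmax_leqP => j _.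
  apply: leq_trans (msizeZ_le _ _) _.
  by rewrite -mpolyXD msizeX mdegD !mdeg1.
move=> x; rewrite fE /p mevalD mevalC; congr (_ + _).
rewrite /qform /dotv raddf_sum mulr_sumr /=; apply: eq_bigr => i _.
rewrite raddf_sum mxE !mulr_sumr /=; apply: eq_bigr => j _.
by rewrite mevalZ mevalM !mevalXU; ring.
Qed.

(** Adding [k / 2] times the squared norm to [sg * u] shifts the Hessian eigenvalues by [k] and
    leaves the phase unchanged, the added term being homogeneous of degree 2. The two Hessian
    conditions of the theorem correspond to two choices of [sg] and [k]. *)
Lemma signed_potential_quadratic (sg k kappa beta : R) (u : 'rV[R]_n -> R) :
  sg ^+ 2 = 1 -> 0 < kappa -> 0 < beta -> class_C2 u ->
  (forall x v, v != 0 -> 0 < qform (sg *: hessian u x + k *: 1%:M) v) ->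
  (forall x l, eigenvalues_of (hessian u x) l -> (forall i, 0 < sg * l i + k) ->
     \sum_i profile kappa beta (sg * l i + k) =
     sg * (- u x + 1 / 2 * dotv x (gradient u x))) ->
  forall x, u x = u 0 + 1 / 2 * qform (hessian u 0) x.
Proof.
move=> sg2 kappa0 beta0 uC2 Hpos Heq.
pose w x := sg * u x + k / 2 * dotv (x - 0) (x - 0).
pose g x := sg *: gradient u x + (k / 2) *: (2 *: (x - 0)).
pose H x := sg *: hessian u x + (k / 2) *: (2 *: 1%:M).
have HE x : H x = sg *: hessian u x + k *: 1%:M.
  by rewrite /H scalerA; congr (_ + _ *: _); field.
have wC2 : line_C2 w g H.
  exact: line_C2D (line_C2Z sg (class_C2_line_C2 uC2)) (line_C2Z (k / 2) (line_C2_sqdist 0)).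
have [[uc Du] D2u] := uC2.
have wc : continuous w.
  apply: ctsD; apply: ctsM => //; try exact: cst_continuous; exact: cts_sqdist.
have gc i : continuous (fun x => g x 0 i).
  rewrite (_ : (fun x => _) = (fun x : 'rV[R]_n => sg * partial i u x + k * x 0 i)).
    apply: ctsD; (apply: ctsM; first exact: cst_continuous).
      exact: (Du i).2.
    exact: cts_coord.
  by apply/funext => x; rewrite !mxE; field.
have Hc i : continuous (fun x => H x i i).
  rewrite (_ : (fun x => _) = (fun x : 'rV[R]_n => sg * partial i (partial i u) x + k)).
    apply: ctsD; last exact: cst_continuous.
    by apply: ctsM; [exact: cst_continuous|exact: ((D2u i).2 i).2].
  by apply/funext => x; rewrite HE !mxE eqxx mulr1.
have Hs x : (H x)^T = H x.
  by rewrite HE linearD !linearZ /= hessian_sym// trmx1.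
have Hp x v : v != 0 -> 0 < qform (H x) v by rewrite HE; exact: Hpos.
have /choice[F HF] x : exists F : ('I_n -> R) * (('I_n -> 'rV[R]_n) * ('I_n -> 'rV[R]_n)),
    spectral_resolution (hessian u x) F.1 F.2.1 F.2.2 /\ eigenvalues_of (hessian u x) F.1.
  have [d [X [Y [H1 H2]]]] := spectral_resolution_exists (hessian_sym x uC2).
  by exists (d, (X, Y)).
pose d x i := sg * (F x).1 i + k.
have Hsp x : spectral_resolution (H x) (d x) (F x).2.1 (F x).2.2.
  have [[X1 X2 X3 X4] _] := HF x; split=> // i.
    by rewrite HE mulmxDr -!scalemxAr X3 mulmx1 scalerA -scalerDl.
  by rewrite HE mulmxDr -!scalemxAr X4 mulmx1 scalerA -scalerDl.
have weq x : \sum_i profile kappa beta (d x i) = phase w g x.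
  have pos i : 0 < sg * (F x).1 i + k by exact: (resolution_gt0 (Hsp x) i (Hp x)).
  by rewrite [LHS](Heq x _ (HF x).2 pos) /phase /w /g !subr0 dotvDr !dotvZr; field.
move=> x; have := core_quadratic kappa0 beta0 wC2 wc gc Hc Hs Hp Hsp weq x.
rewrite /w !subr0 dotv0l mulr0 addr0 HE qformD !qformZ qform1 => E.
have : sg * (u x - (u 0 + 1 / 2 * qform (hessian u 0) x)) = 0.
  by move: E; lra.
move/eqP; rewrite mulf_eq0 => /orP[/eqP sg0|]; last by rewrite subr_eq0 => /eqP.
by move: sg2; rewrite sg0 expr0n /= => /eqP; rewrite eq_sym oner_eq0.
Qed.

(** The double angle is below [pi / 2], so its cosine, [cos tau ^+ 2 - sin tau ^+ 2], is
    positive. *)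
Lemma cot_sqr_gt1 (tau : R) : 0 < tau -> tau < pi / 4 -> 1 < cot tau ^+ 2.
Proof.
move=> tau0 tau1; have p0 : 0 < pi :> R := pi_gt0 R.
have s0 : 0 < sin tau by rewrite sin_gt0_pi// tau0 /=; lra.
have c2 : 0 < cos (tau + tau) by rewrite cos_gt0_pihalf//; apply/andP; split; lra.
rewrite cosD -!expr2 subr_gt0 in c2.
by rewrite /cot expr_div_n ltr_pdivlMr ?exprn_gt0// mul1r.
Qed.

End Reduction.

Theorem theorem1p2 (R : realType) (n : nat) (n_ge1 : (1 <= n)%N)
  (tau a b : R) (tau_gt0 : 0 < tau) (tau_lt : tau < pi / 4)
  (aE : a = cot tau) (bE : b = Num.sqrt (cot tau ^+ 2 - 1))
  (u : 'rV[R]_n -> R) (uC2 : class_C2 u)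
  (lambda : 'rV[R]_n -> 'I_n -> R)
  (lambdaE : forall x : 'rV[R]_n, eigenvalues_of (hessian u x) (lambda x))
  (u_eq : forall x : 'rV[R]_n,
    Num.sqrt (a ^+ 2 + 1) / (2 * b) *
      \sum_(i < n) ln ((lambda x i + a - b) / (lambda x i + a + b))
    = - u x + 1 / 2 * dotv x (gradient u x))
  (u_hess :
    (forall x : 'rV[R]_n, mxform_lt ((- (a - b)) *: 1%:M) (hessian u x)) \/
    (forall x : 'rV[R]_n, mxform_lt (hessian u x) ((- (a + b)) *: 1%:M))) :
  quadratic_polynomial u /\
  exists (A : 'M[R]_n) (lambdabar : 'I_n -> R),
    A^T = A /\
    eigenvalues_of A lambdabar /\
    forall x : 'rV[R]_n,
      u x = - (Num.sqrt (a ^+ 2 + 1) / (2 * b)) *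
              \sum_(i < n) ln ((lambdabar i + a - b) / (lambdabar i + a + b))
            + 1 / 2 * dotv x (x *m A^T).

Proof.
have b2 : 0 < cot tau ^+ 2 - 1 by rewrite subr_gt0 cot_sqr_gt1.
have b0 : 0 < b by rewrite bE sqrtr_gt0.
have kappa0 : 0 < Num.sqrt (a ^+ 2 + 1) / (2 * b).
  by rewrite divr_gt0 ?mulr_gt0// sqrtr_gt0 ltr_wpDl// sqr_ge0.
set kappa := Num.sqrt _ / _ in kappa0 u_eq *.
have beta0 : 0 < 2 * b by rewrite mulr_gt0.
have hT x : (hessian u x)^T = hessian u x by exact: hessian_sym.
have sumE x (l : 'I_n -> R) : eigenvalues_of (hessian u x) l ->
    kappa * \sum_(i < n) ln ((l i + a - b) / (l i + a + b)) =
    - u x + 1 / 2 * dotv x (gradient u x).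
  move=> lE; rewrite -u_eq; congr (_ * _).
  exact: (eigenvalues_of_sum (fun t => ln ((t + a - b) / (t + a + b))) lE (lambdaE x)).
have uq : forall x, u x = u 0 + 1 / 2 * qform (hessian u 0) x.
  case: u_hess => Hh.
  (* Here [mu = l i + a - b] and [mu + 2 * b = l i + a + b]. *)
  - apply: (@signed_potential_quadratic _ _ 1 (a - b) kappa (2 * b)) => //.
    + by rewrite expr1n.
    + move=> x v v0; have := Hh x v v0; rewrite /qform.
      by rewrite linearB linearZ /= trmx1 hT scaleNr opprK scale1r.
    + move=> x l lE lpos; rewrite mul1r -(sumE x l lE) mulr_sumr.
      apply: eq_bigr => i _; rewrite /profile mul1r.
      by congr (_ * ln (_ / _)); ring.
  (* Here [mu = - (l i + a + b)]: the quotient in the profile is the inverse of that in the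
     equation, and the logarithm supplies the sign. *)
  - apply: (@signed_potential_quadratic _ _ (-1) (- (a + b)) kappa (2 * b)) => //.
    + by rewrite sqrrN expr1n.
    + move=> x v v0; have := Hh x v v0; rewrite /qform.
      by rewrite linearB linearZ /= trmx1 hT addrC scaleN1r.
    + move=> x l lE lpos; rewrite mulN1r -(sumE x l lE) mulr_sumr -sumrN.
      apply: eq_bigr => i _; rewrite /profile -mulrN.
      have := lpos i; move: (l i) => t t0.
      have t1 : t + a + b < 0 by move: t0; lra.
      have t2 : t + a - b < 0 by move: t0 b0; lra.
      rewrite -lnV; last by rewrite posrE -mulrNN -invrN divr_gt0 ?oppr_gt0.
      congr (_ * ln _); rewrite invf_div; field.
      by rewrite lt_eqF// gt_eqF//; move: t2; lra.
split; first exact: quadratic_polynomial_qform uq.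
exists (hessian u 0), (lambda 0); split; [exact: hT|split => //] => x.
(* At the origin the equation identifies the logarithmic sum, with its factor, with [- u 0]. *)
rewrite hT uq mulNr u_eq.
by rewrite dotv0l mulr0 addr0 opprK.
Qed.
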